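(* For any finite simplicial complex and every $d\ge0$ such that every $d$-simplex lies in some $(d+1)$-simplex, with $n=\#S_d$, $$\frac{h_1(S_d)^2}{2(d+1)}\le d+2-\lambda_n(\Delta_d^{up})\le 2h_1(S_d).$$ Moreover, there exists an absolute constant $C>0$ such that for any such simplicial complex and any $1\le k\le n$, $$\frac{h_k(S_d)^2}{Ck^6(d+1)}\le d+2-\lambda_{n+1-k}(\Delta_d^{up})\le 2h_k(S_d).$$
   Context: $S_d$ is the set of $d$-simplices of the complex, each with a fixed orientation $[\tau]$; $\mathrm{sgn}([\tau],\partial[\sigma])\in\{-1,1\}$ is the coefficient of $[\tau]$ in the boundary $\partial[\sigma]$ of $\sigma\in S_{d+1}$ when $\tau\subset\sigma$; $\deg_\tau=\#\{\sigma\in S_{d+1}:\tau\subset\sigma\}$. $\lambda_1(\Delta_d^{up})\le\dots\le\lambda_n(\Delta_d^{up})$ are the eigenvalues of the normalized $d$-th up Laplacian, i.e. of the Rayleigh quotient $$f\mapsto\frac{\sum_{\sigma\in S_{d+1}}\big(\sum_{\tau\in S_d,\tau\subset\sigma}\mathrm{sgn}([\tau],\partial[\sigma])f(\tau)\big)^2}{\sum_{\tau\in S_d}\deg_\tau f(\tau)^2},\qquad f\in\mathbb R^{S_d}.$$ Signed graph $G^-_{up}(S_d)$: vertex set $S_d$; distinct $\tau,\tau'$ are adjacent if both are contained in some $\sigma\in S_{d+1}$; the edge sign is $\mathrm{sgn}([\tau],[\tau'])=\mathrm{sgn}([\tau],\partial[\sigma])\,\mathrm{sgn}([\tau'],\partial[\sigma])$.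 For disjoint $A,A'\subset S_d$, $|E_+(A,A')|$ is the number of edges with sign $+1$ between $A$ and $A'$; $|E_-(A)|$ is the number of (unordered) edges with sign $-1$ having both ends in $A$; $|\partial A|$ is the number of edges of $G^-_{up}(S_d)$ between $A$ and $S_d\setminus A$; $\mathrm{vol}(A)=\sum_{\tau\in A}\deg_\tau$. Put $$\beta(A,A')=\frac{2\big(|E_-(A)|+|E_-(A')|+|E_+(A,A')|\big)+|\partial(A\sqcup A')|}{\mathrm{vol}(A\sqcup A')},$$ $$h_k(S_d)=\min\ \max_{1\le i\le k}\beta(A_{2i-1},A_{2i}),$$ the minimum over pairwise disjoint $A_1,A_2,\dots,A_{2k-1},A_{2k}\subset S_d$ with $A_{2i-1}\cup A_{2i}\ne\varnothing$ for each $i$. *)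

(* Defs.v *)
From mathcomp Require Import all_boot all_order all_fingroup all_algebra.
From mathcomp Require Import boolp classical_sets reals.

Set Implicit Arguments.
Unset Strict Implicit.
Unset Printing Implicit Defensive.

Import Order.TTheory GRing.Theory Num.Theory.
Local Open Scope ring_scope.

Section Complex.
Variable V : finType.
Implicit Types (K : {set {set V}}) (s t : {set V}) (d m : nat).

(* Whether the empty simplex belongs to K is left open: only simplices of
   dimension at least 0 are ever used. *)
Definition simplicial_complex K : Prop :=
  forall s t, s \in K -> t \subset s -> t != finset.set0 -> t \in K.

Definition simplices K d : {set {set V}} := [set s in K | #|s| == d.+1].

Definition deg K d t : nat := #|[set s in simplices K d.+1 | t \subset s]|.

(* An orientation is given by representatives: [o m s] is an ordering
   [v_0, ..., v_m] of the vertices of the m-simplex s, standing for its class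
   modulo even permutations. *)
Definition orientation K (o : forall m, {set V} -> m.+1.-tuple V) : Prop :=
  forall m s, s \in simplices K m -> [set v in o m s] = s.

Definition face m (u : m.+2.-tuple V) (i : 'I_m.+2) : m.+1.-tuple V :=
  [tuple tnth u (lift i j) | j < m.+1].

Section Sign.
Variable A : pzRingType.

(* [u] = rel_sign u w [w] as oriented simplices: the signature of the
   permutation that carries w to u, and 0 if there is none.  When w has no
   repeated vertex, at most one p satisfies the condition. *)
Definition rel_sign m (u w : m.-tuple V) : A :=
  \sum_(p : 'S_m | u == [tuple tnth w (p j) | j < m]) (-1) ^+ p.

(* The coefficient of [w] in
   \partial [v_0, ..., v_(m+1)] = \sum_i (-1)^i [v_0, ..., ^v_i, ..., v_(m+1)]. *)
Definition bd_coef m (w : m.+1.-tuple V) (u : m.+2.-tuple V) : A :=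
  \sum_(i < m.+2) (-1) ^+ i * rel_sign (face u i) w.

End Sign.

Section Oriented.
Variables (K : {set {set V}}) (o : forall m, {set V} -> m.+1.-tuple V) (d : nat).

Definition sgn (A : pzRingType) t s : A := bd_coef A (o d t) (o d.+1 s).

(* The signed graph G^-_up(S_d).  Two distinct d-simplices lie in at most one
   common (d+1)-simplex, namely their union, so the sign is well defined. *)
Definition adj : rel {set V} := fun t t' =>
  (t != t') && [exists s in simplices K d.+1, (t \subset s) && (t' \subset s)].

Definition adj_sign (e : int) : rel {set V} := fun t t' =>
  (t != t') && [exists s in simplices K d.+1,
    [&& t \subset s, t' \subset s & sgn int t s * sgn int t' s == e]].

(* Edges are unordered pairs, so [edges r A A] counts each of them once. *)
Definition edges (r : rel {set V}) (A B : {set {set V}}) : {set {set {set V}}} :=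
  [set [set t; t'] | t in A, t' in B & r t t'].

Definition vol (A : {set {set V}}) : nat := \sum_(t in A) deg K d t.

Section Real.
Variable R : realType.

Definition beta (A B : {set {set V}}) : R :=
  (2 * (#|edges (adj_sign (-1)) A A| + #|edges (adj_sign (-1)) B B|
        + #|edges (adj_sign 1) A B|)
   + #|edges adj (A :|: B) (simplices K d :\: (A :|: B))|)%N%:R
  / (vol (A :|: B))%:R.

(* A (i, false) and A (i, true) stand for A_(2i-1) and A_(2i). *)
Definition admissible k (A : {ffun 'I_k * bool -> {set {set V}}}) : bool :=
  [&& [forall x, A x \subset simplices K d],
      [forall x, forall y, (x != y) ==> [disjoint A x & A y]]
    & [forall i, A (i, false) :|: A (i, true) != finset.set0]].

(* beta is nonnegative, so the initial value 0 of the maximum plays no role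
   when k > 0. *)
Definition max_beta k (A : {ffun 'I_k * bool -> {set {set V}}}) : R :=
  \big[Order.max/0]_(i < k) beta (A (i, false)) (A (i, true)).

Definition cheeger k : R :=
  inf [set x | exists2 A, @admissible k A & x = max_beta A]%classic.

(* There are finitely many admissible families, so the infimum is a minimum. *)
Lemma cheeger_min k (A0 : {ffun 'I_k * bool -> {set {set V}}}) :
  admissible A0 ->
  exists2 A, @admissible k A &
    cheeger k = max_beta A /\
    forall B, @admissible k B -> max_beta A <= max_beta B.
Proof.
move=> A0ok; case: (Order.TotalTheory.arg_minP (@max_beta k) A0ok).
move=> A Aok Amin; exists A => //; split=> //.
apply/eqP; rewrite eq_le; apply/andP; split.
- apply: ge_inf; last by exists A.
  by exists (max_beta A) => x [B /Amin ? ->].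
- apply: lb_le_inf; first by exists (max_beta A); exists A.
  by move=> x [B /Amin ? ->].
Qed.

Definition simplex (i : 'I_#|simplices K d|) : {set V} := enum_val i.

(* The matrix of the normalized d-th up Laplacian in the basis of indicator
   functions of d-simplices:
   (Delta f)(t) = 1/deg_t \sum_(s > t) sgn(t,s) \sum_(t' < s) sgn(t',s) f(t'). *)
Definition up_laplacian : 'M[R]_#|simplices K d| :=
  \matrix_(i, j) ((deg K d (simplex i))%:R^-1 *
    \sum_(s in simplices K d.+1 | (simplex i \subset s) && (simplex j \subset s))
       sgn R (simplex i) s * sgn R (simplex j) s).

Definition every_simplex_in_coface : Prop :=
  forall t, t \in simplices K d ->
    exists2 s, s \in simplices K d.+1 & t \subset s.

(* up_laplacian is the operator of the Rayleigh quotient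
   \sum_s (\sum_(t < s) sgn(t,s) f(t))^2 / \sum_t deg_t f(t)^2: the symmetric
   bilinear form of the numerator is <g, Delta f> for the inner product of the
   denominator. *)
Lemma up_laplacian_form (f g : {set V} -> R) :
  every_simplex_in_coface ->
  \sum_i (deg K d (simplex i))%:R * g (simplex i) *
      (up_laplacian *m \col_j f (simplex j)) i ord0
  = \sum_(s in simplices K d.+1)
      (\sum_(t in simplices K d | t \subset s) sgn R t s * g t) *
      (\sum_(t in simplices K d | t \subset s) sgn R t s * f t).
Proof.
move=> cof.
have deg_neq0 t : t \in simplices K d -> (deg K d t)%:R != 0 :> R.
  move=> /cof [s sK ts]; rewrite pnatr_eq0 -lt0n card_gt0.
  by apply/set0Pn; exists s; rewrite inE sK.
transitivity (\sum_(t in simplices K d) \sum_(t' in simplices K d)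
   \sum_(s in simplices K d.+1 | (t \subset s) && (t' \subset s))
     (sgn R t s * g t) * (sgn R t' s * f t')).
  rewrite [RHS]big_enum_val; apply: eq_bigr => i _.
  rewrite mxE mulr_sumr [RHS]big_enum_val; apply: eq_bigr => j _.
  have D0 := deg_neq0 _ (enum_valP i).
  have cancel (D x S y : R) : D != 0 -> D * x * (D^-1 * S * y) = S * (x * y).
    by move=> ?; rewrite -!mulrA [x * _]mulrCA mulVKf // mulrCA.
  rewrite !mxE cancel // mulr_suml; apply: eq_bigr => s _.
  by rewrite mulrACA.
transitivity (\sum_(t in simplices K d) \sum_(t' in simplices K d)
   \sum_(s in simplices K d.+1) (if (t \subset s) && (t' \subset s) then
     (sgn R t s * g t) * (sgn R t' s * f t') else 0)).
  by do 2!(apply: eq_bigr => ? _); rewrite big_mkcondr.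
under eq_bigr do rewrite exchange_big.
rewrite exchange_big; apply: eq_bigr => s _ /=.
rewrite big_distrlr /= [RHS]big_mkcondr; apply: eq_bigr => t _.
case: ifP => ts; last by rewrite big1.
by rewrite [RHS]big_mkcondr.
Qed.

(* lam lists the eigenvalues with multiplicity, in nondecreasing order.  By
   up_laplacian_form, up_laplacian is self-adjoint for the deg-weighted inner
   product when all degrees are positive, so lam then exists and is unique. *)
Definition up_spectrum (lam : seq R) : Prop :=
  sorted <=%R lam /\ char_poly up_laplacian = \prod_(x <- lam) ('X - x%:P).

End Real.
End Oriented.
End Complex.

(* 1-based indexing of the eigenvalues. *)
Definition lambda (R : realType) (lam : seq R) (i : nat) : R := lam`_i.-1.

(* Main.v *)
Require Import Defs.
From mathcomp Require Import all_boot all_order all_fingroup all_algebra.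
From mathcomp Require Import boolp classical_sets reals.
From mathcomp Require Import ring lra zify.
Import Order.TTheory GRing.Theory Num.Theory.
Local Open Scope ring_scope.

Set Implicit Arguments.
Unset Strict Implicit.
Unset Printing Implicit Defensive.

(** For a coface s, the d + 2 numbers x_t = sgn(t, s) f(t) satisfy
      (sum x_t)^2 + sum over pairs (x_t - x_t')^2 = (d + 2) sum x_t^2,
    and two d-simplices have at most one common coface. Summing over s, d + 2
    minus the Rayleigh quotient of the up Laplacian is the quotient of the energy
    sum over edges (f(t) - sgn(t, t') f(t'))^2 by sum deg_t f(t)^2
    ([coface_energy]). So mu_k = d + 2 - lambda_(n+1-k) is the k-th smallest
    eigenvalue of a signed graph whose vertex t has mass deg_t and d + 1 times as
    many edges; and beta(A, A') is the total variation of 1_A - 1_A' divided by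
    its mass ([beta_variation]). What remains is a Cheeger inequality for signed
    graphs.

    Upper bounds. On the span of k functions 1_A - 1_A' with disjoint supports,
    the energy is at most twice the largest beta times the squared norm
    ([energy_combination_le]), and this span meets the orthogonal complement of
    k - 1 eigenvectors ([eigenvalue_le_max_beta]).

    Lower bounds. Sweeping over the level sets of f|f| turns a function of
    Rayleigh quotient mu into a pair (A, A') inside its support with
    beta^2 <= 2 (d + 1) mu ([cheeger_cut]). For k = 1 this is applied to an
    eigenvector. For general k it is applied to k functions with disjoint
    supports, obtained from k eigenvectors F_1, ..., F_k by [localization]: the
    Rayleigh quotients become O(k^5) mu_k.

    The localization works in R^k. An edge of small energy joins vertices x, y
    with F(x) close to F(y) or to -F(y). Each coordinate of the direction
    F(x)/|F(x)| is cut by a family of walls, symmetric about 0, and F is multiplied by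
    a cutoff that vanishes at the walls. Vertices in one cell, or in
    two opposite cells, have almost parallel images; as F is isotropic by
    orthonormality, they carry a mass at most slightly above 1 ([aligned_mass]).
    The total mass being k, the pairs of opposite cells can be gathered into k
    groups of mass at least 1/2 ([group_weights]), and the restrictions of F to
    the groups are the wanted functions, up to the choice of a coordinate. The
    cutoff is cheap because the walls can be placed in O(k^2) disjoint ways: in
    each coordinate some placement costs no more than twice the average, both in
    mass and in energy ([exists_walls]). *)

(** * Signed graphs: energy and variation *)

(** The right-hand side exceeds the left-hand side by half of
    the sum of w_i w_j (f_i g_j - f_j g_i)^2 over all i, j. *)
Lemma sum_CauchySchwarz (R : realType) (I : finType) (w f g : I -> R) :
  (forall i, 0 <= w i) ->
  (\sum_i w i * (f i * g i)) ^+ 2 <=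
    (\sum_i w i * f i ^+ 2) * (\sum_i w i * g i ^+ 2).
Proof.
move=> w0.
set A := \sum_i w i * f i ^+ 2; set B := \sum_i w i * g i ^+ 2.
set C := \sum_i _.
have : 0 <= \sum_i \sum_j w i * w j * (f i * g j - f j * g i) ^+ 2.
  apply: sumr_ge0 => i _; apply: sumr_ge0 => j _.
  by rewrite mulr_ge0 ?sqr_ge0 ?mulr_ge0 ?w0.
rewrite (eq_bigr (fun i => (w i * f i ^+ 2) * B + (w i * g i ^+ 2) * A
                  - 2 * (w i * (f i * g i)) * C)); last first.
  move=> i _; rewrite !mulr_sumr -sumrN -!big_split /=.
  by apply: eq_bigr => j _; ring.
rewrite !big_split /= sumrN -!mulr_suml -/A -/B -mulr_sumr -/C.
rewrite expr2 => H; nra.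
Qed.

(** Moving a and b towards 0 by t keeps their order, and so do the signs; the
    hypotheses exclude that a nonzero number crosses 0. So the two parts of
    a - b have the same sign and their absolute values add up. *)
Lemma normB_peel (R : realType) (a b t : R) : 0 <= t ->
  (a = 0 \/ t <= `|a|) -> (b = 0 \/ t <= `|b|) ->
  `|a - b| = t * `|Num.sg a - Num.sg b|
             + `|a - t * Num.sg a - (b - t * Num.sg b)|.
Proof.
move=> t0.
have key (x y : R) : 0 <= x -> y <= 0 -> (x = 0 \/ t <= `|x|) -> (y = 0 \/ t <= `|y|) ->
  `|x - y| = t * `|Num.sg x - Num.sg y| + `|x - t * Num.sg x - (y - t * Num.sg y)|.
  move=> x0 y0 hx hy.
  have hx' : 0 <= x - t * Num.sg x.
    case: hx => [->|]; first by rewrite sgr0; lra.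
    by rewrite (ger0_norm x0) => tx; case: (sgrP x) => [||] ?; lra.
  have hy' : y - t * Num.sg y <= 0.
    case: hy => [->|]; first by rewrite sgr0; lra.
    by rewrite (ler0_norm y0) => ty; case: (sgrP y) => [||] ?; lra.
  have sx : 0 <= Num.sg x by rewrite sgr_ge0.
  have sy : Num.sg y <= 0 by rewrite sgr_le0.
  by rewrite !ger0_norm ?subr_ge0 ?(le_trans y0) ?(le_trans sy) ?(le_trans hy') //; ring.
have [a0|a0] := leP 0 a; have [b0|b0] := leP b 0 => ha hb.
- exact: key.
- move: a0; rewrite le_eqVlt => /predU1P[<-|a0].
    rewrite sgr0 mulr0 subrr !sub0r !normrN.
    have := key b 0 (ltW b0) (lexx _) hb (or_introl erefl).
    by rewrite sgr0 mulr0 !subr0.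
  by rewrite !gtr0_sg // subrr normr0 mulr0 add0r; congr `|_|; ring.
- move: b0; rewrite le_eqVlt => /predU1P[->|b0].
    rewrite sgr0 mulr0 !subr0.
    have := key 0 a (lexx _) (ltW a0) (or_introl erefl) ha.
    by rewrite sgr0 mulr0 subrr !sub0r !normrN.
  by rewrite !ltr0_sg // subrr normr0 mulr0 add0r; congr `|_|; ring.
- rewrite (distrC a) (distrC (Num.sg a)) (distrC (a - _)).
  exact: key (ltW b0) (ltW a0) hb ha.
Qed.

(** The sign is a total function, so that its square is 1 at all pairs. *)
Record signed_graph (R : realType) (T : finType) := SignedGraph {
  weight : T -> T -> R;
  esign : T -> T -> R;
  vmass : T -> R;
  weight_ge0 : forall x y, 0 <= weight x y;
  weight_sym : forall x y, weight x y = weight y x;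
  esign_sym : forall x y, esign x y = esign y x;
  esign_pm1 : forall x y, esign x y = 1 \/ esign x y = -1;
  vmass_gt0 : forall x, 0 < vmass x }.

Section SignedGraphTheory.
Variables (R : realType) (T : finType) (G : signed_graph R T).
Local Notation weight := (weight G).
Local Notation esign := (esign G).
Local Notation vmass := (vmass G).
Implicit Types f g : T -> R.

(** Every edge occurs as two ordered pairs, whence the factors 1/2. *)
Definition energy f : R :=
  2^-1 * \sum_x \sum_y weight x y * (f x - esign x y * f y) ^+ 2.
Definition variation f : R :=
  2^-1 * \sum_x \sum_y weight x y * `|f x - esign x y * f y|.
Definition inner f g : R := \sum_x vmass x * (f x * g x).
Definition mass f : R := \sum_x vmass x * `|f x|.

Lemma esign_norm x y : `|esign x y| = 1.
Proof. by case: (esign_pm1 G x y) => ->; rewrite ?normrN normr1. Qed.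

Lemma esign_sqr x y : esign x y ^+ 2 = 1.
Proof. by case: (esign_pm1 G x y) => ->; rewrite ?sqrrN expr1n. Qed.

Lemma energy_ge0 f : 0 <= energy f.
Proof.
rewrite mulr_ge0 ?invr_ge0 ?ler0n // sumr_ge0 // => x _.
by rewrite sumr_ge0 // => y _; rewrite mulr_ge0 ?weight_ge0 ?sqr_ge0.
Qed.

Lemma variation_ge0 f : 0 <= variation f.
Proof.
rewrite mulr_ge0 ?invr_ge0 ?ler0n // sumr_ge0 // => x _.
by rewrite sumr_ge0 // => y _; rewrite mulr_ge0 ?weight_ge0.
Qed.

Lemma mass_ge0 f : 0 <= mass f.
Proof. by rewrite sumr_ge0 // => x _; rewrite mulr_ge0 // ltW ?vmass_gt0. Qed.

Lemma mass_gt0 f x : f x != 0 -> 0 < mass f.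
Proof.
move=> fx; rewrite /mass (bigD1 x) //= ltr_pwDl //.
  by rewrite mulr_gt0 ?vmass_gt0 ?normr_gt0.
by rewrite sumr_ge0 // => y _; rewrite mulr_ge0 // ltW ?vmass_gt0.
Qed.

Lemma inner_ge0 f : 0 <= inner f f.
Proof.
by rewrite sumr_ge0 // => x _; rewrite mulr_ge0 -?expr2 ?sqr_ge0 // ltW ?vmass_gt0.
Qed.

(** On an edge (x, y) the differences d_i = h_i(x) - sg h_i(y) satisfy
    sum |d_i| <= 2, so Cauchy-Schwarz with the weights |d_i| gives
    (sum c_i d_i)^2 <= 2 sum c_i^2 |d_i|. In this way an edge between two
    supports costs no more than its boundary contributions to both. *)
Lemma energy_combination_le (I : finType) (c : I -> R) (h : I -> T -> R) :
  (forall x, \sum_i `|h i x| <= 1) ->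
  energy (fun x => \sum_i c i * h i x) <= 2 * \sum_i c i ^+ 2 * variation (h i).
Proof.
move=> h1; rewrite /energy.
have -> : 2 * (\sum_i c i ^+ 2 * variation (h i)) = 2^-1 * \sum_x \sum_y
    weight x y * (2 * \sum_i `|h i x - esign x y * h i y| * c i ^+ 2).
  rewrite mulr_sumr [RHS]mulr_sumr.
  under [RHS]eq_bigr => x _.
    rewrite mulr_sumr; under eq_bigr => y _ do rewrite !mulr_sumr.
    rewrite exchange_big; over.
  rewrite [RHS]exchange_big; apply: eq_bigr => i _ /=.
  rewrite /variation !mulr_sumr; apply: eq_bigr => x _.
  rewrite !mulr_sumr; apply: eq_bigr => y _; ring.
apply: ler_wpM2l; first by rewrite invr_ge0 ler0n.
apply: ler_sum => x _; apply: ler_sum => y _.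
apply: ler_wpM2l; first exact: weight_ge0.
set d := fun i => h i x - esign x y * h i y.
have -> : \sum_i c i * h i x - esign x y * \sum_i c i * h i y = \sum_i c i * d i.
  rewrite mulr_sumr -sumrB; apply: eq_bigr => i _; rewrite /d; ring.
have d2 : \sum_i `|d i| <= 2.
  apply: (@le_trans _ _ (\sum_i (`|h i x| + `|h i y|))).
    apply: ler_sum => i _; apply: (le_trans (ler_normB _ _)).
    by rewrite normrM esign_norm mul1r.
  by rewrite big_split /= -[2]/(1 + 1) lerD.
have := sum_CauchySchwarz c (fun i => Num.sg (d i)) (fun i => normr_ge0 (d i)).
rewrite (eq_bigr (fun i => c i * d i)); last first.
  by move=> i _; rewrite mulrCA [`|_| * _]mulrC -numEsg.
move=> /le_trans; apply.
rewrite mulrC; apply: ler_wpM2r.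
  by apply: sumr_ge0 => i _; rewrite mulr_ge0 ?sqr_ge0.
apply: le_trans d2; apply: ler_sum => i _.
by rewrite sqr_sg; case: (_ == _); rewrite ?mulr1 ?mulr0.
Qed.

(** * Sweeping over level sets *)

(** One step of the discrete coarea formula: the part of g below level t can be
    split off, with no cancellation, when |g| takes no value in (0, t). *)
Lemma variation_peel t g : 0 <= t -> (forall x, g x = 0 \/ t <= `|g x|) ->
  variation g = t * variation (fun x => Num.sg (g x))
                + variation (fun x => g x - t * Num.sg (g x)).
Proof.
move=> t0 gt; rewrite /variation mulrCA -mulrDr; congr (_ * _).
rewrite mulr_sumr -big_split; apply: eq_bigr => x _ /=.
rewrite mulr_sumr -big_split; apply: eq_bigr => y _ /=.
rewrite mulrCA -mulrDr; congr (_ * _).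
have -> : Num.sg (g x) - esign x y * Num.sg (g y)
          = Num.sg (g x) - Num.sg (esign x y * g y).
  by case: (esign_pm1 G x y) => ->; rewrite ?mul1r // !mulN1r sgrN.
have -> : g x - t * Num.sg (g x) - esign x y * (g y - t * Num.sg (g y))
    = g x - t * Num.sg (g x) - (esign x y * g y - t * Num.sg (esign x y * g y)).
  by case: (esign_pm1 G x y) => ->; rewrite ?mul1r // !mulN1r sgrN; ring.
have ht : esign x y * g y = 0 \/ t <= `|esign x y * g y|.
  by rewrite normrM esign_norm mul1r; case: (gt y) => [->|]; [left; rewrite mulr0 | right].
exact: normB_peel.
Qed.

Lemma mass_peel t g : 0 <= t -> (forall x, g x = 0 \/ t <= `|g x|) ->
  mass g = t * mass (fun x => Num.sg (g x))
           + mass (fun x => g x - t * Num.sg (g x)).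
Proof.
move=> t0 gt; rewrite mulr_sumr -big_split; apply: eq_bigr => x _ /=.
rewrite mulrCA -mulrDr; congr (_ * _).
have := normB_peel t0 (gt x) (or_introl (erefl 0)).
by rewrite sgr0 mulr0 !subr0.
Qed.

(** Peeling off one level after another writes g as a positive combination of
    signs of level sets, along which variation and mass are both additive. So the
    quotient of g is a mediant of the quotients of the level sets, and one of
    these is at most that of g. *)
Lemma sweep_cut g x0 : g x0 != 0 -> exists chi : T -> R,
  [/\ exists x, chi x != 0,
      forall x, [\/ chi x = 0, chi x = 1 | chi x = -1],
      forall x, g x = 0 -> chi x = 0
    & variation chi * mass g <= variation g * mass chi].
Proof.
have [n] := ubnP #|[set x | g x != 0]|; elim: n g x0 => // n IH g x0 gn gx0.
case: (@Order.TotalTheory.arg_minP _ _ _ x0 (fun x => g x != 0)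
  (fun x => `|g x|) gx0) => z gz zmin.
set t := `|g z|; set chi := fun x => Num.sg (g x).
set h := fun x => g x - t * chi x.
have t0 : 0 < t by rewrite normr_gt0.
have gt x : g x = 0 \/ t <= `|g x|.
  by have [->|/zmin] := eqVneq (g x) 0; [left | right].
have Ev : variation g = t * variation chi + variation h.
  exact: variation_peel (ltW t0) gt.
have Em : mass g = t * mass chi + mass h by exact: mass_peel (ltW t0) gt.
have chi1 x : [\/ chi x = 0, chi x = 1 | chi x = -1].
  by rewrite /chi; case: sgrP => _; [constructor 1|constructor 2|constructor 3].
have chi0 x : g x = 0 -> chi x = 0 by rewrite /chi => ->; rewrite sgr0.
have chix : exists x, chi x != 0 by exists x0; rewrite /chi sgr_eq0.
have h0 x : g x = 0 -> h x = 0 by rewrite /h => gx; rewrite gx chi0 // mulr0 subr0.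
have [hnz|hz] := pselect (exists x, h x != 0); last first.
  exists chi; split => //.
  have h0' x : h x = 0 by apply/eqP; apply: contrapT => /negP hx; apply: hz; exists x.
  have mh : mass h = 0 by rewrite /mass big1 // => x _; rewrite h0' normr0 mulr0.
  by rewrite Em mh Ev; have := mulr_ge0 (variation_ge0 h) (mass_ge0 chi); lra.
have [x1 hx1] := hnz.
have [|chi' [cx c1 c0 cc]] := IH h x1 _ hx1.
  rewrite -ltnS; apply: leq_trans gn; rewrite ltnS; apply: proper_card.
  apply/properP; split.
    by apply/fintype.subsetP => x; rewrite !inE; apply: contraNneq => /h0 ->.
  exists z; rewrite !inE // negbK /h /t /chi mulrC -numEsg subrr //.
have [le1|le2] := leP (variation chi * mass g) (variation g * mass chi).
  by exists chi.
exists chi'; split=> // [x /h0 /c0 //|].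
have mc : 0 < mass chi by case: chix => x; apply: mass_gt0.
have Vh := variation_ge0 h; have Mh := mass_ge0 h; have Mc' := mass_ge0 chi'.
rewrite Ev Em in le2 *.
have lt1 : variation h * mass chi < variation chi * mass h by nra.
have Mh0 : 0 < mass h.
  rewrite lt_def Mh andbT; apply: contraTneq lt1 => ->.
  by rewrite mulr0 -leNgt mulr_ge0 // ltW.
have le3 : variation chi' * mass chi <= variation chi * mass chi'.
  rewrite -(ler_pM2r Mh0); apply: (@le_trans _ _ (variation h * mass chi' * mass chi)).
    by rewrite mulrAC ler_wpM2r // ltW.
  by rewrite mulrAC [leRHS]mulrAC ler_wpM2r // ltW.
rewrite mulrDr mulrDl lerD //.
by rewrite mulrCA -[leRHS]mulrA ler_wpM2l // ltW.
Qed.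
End SignedGraphTheory.

Lemma normB_mul_norm (R : realType) (a b : R) :
  `|a * `|a| - b * `|b| | <= `|a - b| * (`|a| + `|b|).
Proof.
case: (ger0P a) => a0; case: (ger0P b) => b0.
- rewrite (_ : a * a - b * b = (a - b) * (a + b)) ?normrM; last by ring.
  by rewrite (ger0_norm (addr_ge0 a0 b0)).
- rewrite ger0_norm ?ger0_norm; nra.
- rewrite ler0_norm ?ler0_norm; nra.
- rewrite (_ : a * - a - b * - b = (a - b) * (- a - b)) ?normrM; last by ring.
  by rewrite (@ger0_norm _ (- a - b)); last lra.
Qed.

Section Cheeger.
Variables (R : realType) (T : finType) (G : signed_graph R T).
Local Notation weight := (weight G).
Local Notation esign := (esign G).
Local Notation vmass := (vmass G).
Implicit Types f g : T -> R.
Variable D : R.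
Hypothesis degD : forall x, \sum_y weight x y <= D * vmass x.

Lemma sum_weight_sqr_le f :
  \sum_x \sum_y weight x y * (f x ^+ 2 + f y ^+ 2) <= 2 * D * inner G f f.
Proof.
have W : \sum_x \sum_y weight x y * f x ^+ 2 <= D * inner G f f.
  rewrite mulr_sumr; apply: ler_sum => x _.
  by rewrite -mulr_suml mulrA -expr2 ler_wpM2r ?sqr_ge0.
under eq_bigr do (under eq_bigr do rewrite mulrDr; rewrite big_split).
rewrite big_split /= [X in _ + X]exchange_big /=.
rewrite [X in _ + X](_ : _ = \sum_x \sum_y weight x y * f x ^+ 2).
  by lra.
by do 2! apply: eq_bigr => ? _; rewrite weight_sym.
Qed.

(** The factor |f(x)| + |f(y)| split off by [normB_mul_norm] is turned by
    Cauchy-Schwarz into the degree bound D. *)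
Lemma variation_sqr_le f :
  variation G (fun x => f x * `|f x|) ^+ 2 <= 2 * D * energy G f * inner G f f.
Proof.
set g := fun x => _.
pose w (p : T * T) := weight p.1 p.2.
pose u p := `|f p.1 - esign p.1 p.2 * f p.2|.
pose v (p : T * T) := `|f p.1| + `|f p.2|.
have gle : variation G g <= 2^-1 * \sum_p w p * (u p * v p).
  rewrite ler_wpM2l ?invr_ge0 ?ler0n // pair_bigA; apply: ler_sum => p _.
  rewrite ler_wpM2l ?weight_ge0 // /u /v /g.
  have := normB_mul_norm (f p.1) (esign p.1 p.2 * f p.2).
  by rewrite normrM esign_norm mul1r mulrA.
have CS := sum_CauchySchwarz u v (fun p => weight_ge0 G p.1 p.2).
have E : \sum_p w p * u p ^+ 2 = 2 * energy G f.
  rewrite /energy mulrA divff ?pnatr_eq0 // mul1r pair_bigA.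
  by apply: eq_bigr => p _; rewrite real_normK ?num_real.
have V : \sum_p w p * v p ^+ 2 <= 4 * D * inner G f f.
  have := sum_weight_sqr_le f; rewrite pair_bigA /= => W.
  apply: (@le_trans _ _ (2 * \sum_p w p * (f p.1 ^+ 2 + f p.2 ^+ 2))); last by rewrite /w; lra.
  rewrite mulr_sumr; apply: ler_sum => p _; rewrite [leRHS]mulrCA ler_wpM2l ?weight_ge0 //.
  rewrite -(real_normK (num_real (f p.1))) -(real_normK (num_real (f p.2))) /v.
  have := sqr_ge0 (`|f p.1| - `|f p.2|); lra.
have g0 := variation_ge0 G g; have E0 := energy_ge0 G f.
apply: (@le_trans _ _ ((2^-1 * \sum_p w p * (u p * v p)) ^+ 2)).
  by rewrite lerXn2r ?nnegrE ?(le_trans g0).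
rewrite exprMn.
apply: (@le_trans _ _ (2^-1 ^+ 2 * (2 * energy G f * (4 * D * inner G f f)))); last by lra.
rewrite ler_wpM2l ?sqr_ge0 //; apply: (le_trans CS).
by rewrite -/w E ler_wpM2l // mulr_ge0.
Qed.

(** The sweep runs over the level sets of f|f| instead of those of f, because
    the mass of f|f| is the squared norm of f. *)
Lemma cheeger_cut f x0 : f x0 != 0 -> exists chi : T -> R,
  [/\ exists x, chi x != 0,
      forall x, [\/ chi x = 0, chi x = 1 | chi x = -1],
      forall x, f x = 0 -> chi x = 0
    & variation G chi ^+ 2 * inner G f f <= 2 * D * energy G f * mass G chi ^+ 2].
Proof.
move=> fx0; set g := fun x => f x * `|f x|.
have gx0 : g x0 != 0 by rewrite mulf_neq0 // normr_eq0.
have [chi [chix chi1 chi0 ineq]] := sweep_cut G gx0.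
exists chi; split=> // [x fx|]; first by apply: chi0; rewrite /g fx mul0r.
have mg : mass G g = inner G f f.
  apply: eq_bigr => x _; congr (_ * _).
  by rewrite /g normrM normr_id -normrM ger0_norm // -expr2 sqr_ge0.
have V0 : 0 < inner G f f by rewrite -mg (mass_gt0 _ gx0).
rewrite mg in ineq.
have Vg := variation_sqr_le f; rewrite -/g in Vg.
rewrite -(ler_pM2r V0); apply: (@le_trans _ _ ((variation G chi * inner G f f) ^+ 2)).
  by rewrite le_eqVlt; apply/orP; left; apply/eqP; ring.
apply: (@le_trans _ _ ((variation G g * mass G chi) ^+ 2)).
  apply: lerXn2r; rewrite ?nnegrE //.
    exact: mulr_ge0 (variation_ge0 _ _) (ltW V0).
  exact: mulr_ge0 (variation_ge0 _ _) (mass_ge0 _ _).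
by rewrite exprMn [leRHS]mulrAC ler_wpM2r ?sqr_ge0.
Qed.
End Cheeger.

(** * Walls on the line *)
Lemma sum_residues (R : realType) (N M : nat) (F : nat -> R) :
  \sum_(a < N) \sum_(m < M) F (a + m * N)%N = \sum_(i < M * N) F i.
Proof.
rewrite exchange_big /= -(big_mkord xpredT F) big_nat_mul big_mkord.
apply: eq_bigr => m _.
rewrite -[in RHS](add0n (m * N)%N) big_addn mulSn addnK big_mkord.
by apply: eq_bigr.
Qed.

Section Ramps.
Variable R : realType.
Implicit Types y z : R.

Definition clamp (b : R) z : R := Num.max 0 (Num.min b z).
(** The i-th wall is the zero i + 1/2 of the i-th ramp, which increases from -1
    to 1 on [i, i + 1]. *)
Definition ramp (i : nat) z : R := 2 * clamp 1 (z - i%:R) - 1.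

Lemma clampP b z : 0 <= b ->
  [\/ z <= 0 /\ clamp b z = 0, 0 <= z <= b /\ clamp b z = z
    | b <= z /\ clamp b z = b].
Proof.
rewrite /clamp => b0; have [z0|z0] := leP z 0.
  by constructor 1; split=> //; apply/max_idPl; rewrite ge_min z0 orbT.
have [zb|zb] := leP z b.
  by constructor 2; split=> //; [rewrite ltW | apply/max_idPr; exact: ltW].
by constructor 3; split; [exact: ltW | exact/max_idPr].
Qed.

Lemma clamp_itv b z : 0 <= b -> 0 <= clamp b z <= b.
Proof. by move=> b0; rewrite /clamp le_max lexx /= ge_max b0 ge_min lexx. Qed.

Lemma ler_clamp b y z : 0 <= b -> y <= z -> clamp b y <= clamp b z.
Proof. by move=> b0 yz; case: (clampP y b0) => -[? ->]; case: (clampP z b0) => -[? ->]; lra. Qed.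

Lemma ler_ramp i y z : y <= z -> ramp i y <= ramp i z.
Proof. by move=> yz; have := @ler_clamp 1 (y - i%:R) (z - i%:R) ler01; rewrite /ramp; lra. Qed.

Lemma ramp_norm_le1 i z : `|ramp i z| <= 1.
Proof. by have := @clamp_itv 1 (z - i%:R) ler01; rewrite ler_norml /ramp; lra. Qed.

Lemma sum_clamp W z : \sum_(i < W) clamp 1 (z - i%:R) = clamp W%:R z.
Proof.
elim: W => [|W IH]; first by rewrite big_ord0; case: (clampP z (lexx 0)) => -[? ->]; lra.
rewrite big_ord_recr /= IH -natr1.
have : 0 <= W%:R :> R by [].
move=> W0; have W1 : 0 <= W%:R + 1 :> R by lra.
by case: (clampP z W0) => -[? ->]; case: (clampP z W1) => -[? ->];
  case: (clampP (z - W%:R) ler01) => -[? ->]; lra.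
Qed.

(** The ramps of consecutive walls are monotone and add up to a clamped affine
    function. *)
Lemma sum_dist_ramp W y z :
  \sum_(i < W) `|ramp i y - ramp i z| = 2 * `|clamp W%:R y - clamp W%:R z|.
Proof.
wlog yz : y z / z <= y => [H|].
  have [|/ltW yz] := leP z y; first exact: H.
  rewrite (distrC (clamp _ y)) -H //; apply: eq_bigr => i _; exact: distrC.
rewrite ger0_norm ?subr_ge0 ?ler_clamp ?ler0n // -!sum_clamp -sumrB mulr_sumr.
apply: eq_bigr => i _; rewrite ger0_norm ?subr_ge0 ?ler_ramp // /ramp; ring.
Qed.

(** The functions 1 - |ramp i| live on the disjoint intervals (i, i + 1). *)
Lemma sum_ramp_loss W z : \sum_(i < W) (1 - `|ramp i z|) <= 1.
Proof.
suff [] : \sum_(i < W) (1 - `|ramp i z|) <= 1 /\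
    (W%:R <= z -> \sum_(i < W) (1 - `|ramp i z|) = 0) by [].
elim: W => [|W [IH1 IH0]]; first by rewrite big_ord0.
rewrite !big_ord_recr /= -natr1.
have hr : 1 - `|ramp W z| = 0 \/ W%:R < z < W%:R + 1.
  have [zW|Wz] := leP z W%:R.
    left; rewrite (_ : ramp W z = -1) ?normrN1 ?subrr //.
    by rewrite /ramp; case: (clampP (z - W%:R) ler01) => -[? ->]; lra.
  have [zW|zW] := leP (W%:R + 1) z; last by right; rewrite ?Wz ?zW.
  left; rewrite (_ : ramp W z = 1) ?normr1 ?subrr //.
  by rewrite /ramp; case: (clampP (z - W%:R) ler01) => -[? ->]; lra.
split.
  case: hr => [->|/andP[/ltW/IH0-> _]]; first by rewrite addr0.
  by rewrite add0r gerBl.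
move=> Wz; case: hr => [->|]; last lra.
by rewrite addr0 IH0 //; lra.
Qed.

Lemma ramp_ge0 i z : i%:R + 2^-1 < z -> 0 <= ramp i z.
Proof.
by move=> iz; rewrite /ramp; case: (clampP (z - i%:R) ler01) => -[? ->]; lra.
Qed.

Lemma ramp_le0 i z : z <= i%:R + 2^-1 -> ramp i z <= 0.
Proof.
by move=> iz; rewrite /ramp; case: (clampP (z - i%:R) ler01) => -[? ->]; lra.
Qed.

(** A ramp has opposite signs on the two sides of its wall. *)
Lemma ramp_separated i y z :
  (i%:R + 2^-1 < y) != (i%:R + 2^-1 < z) -> `|ramp i y| <= `|ramp i y - ramp i z|.
Proof.
have [/ramp_ge0 ry|/ramp_le0 ry] := ltP _ y;
  have [/ramp_ge0 rz|/ramp_le0 rz] := ltP _ z => // _.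
  by rewrite !ger0_norm //; lra.
by rewrite !ler0_norm //; lra.
Qed.

(** The walls of residue a modulo N, and their opposites. Both signs are taken
    because F(x) is compared with F(y) as well as with -F(y). *)
Definition jump (N M : nat) (a : nat) y z : R :=
  \sum_(q : 'I_M * bool) `|ramp (a + q.1 * N) ((-1) ^+ q.2 * y)
                           - ramp (a + q.1 * N) ((-1) ^+ q.2 * z)|.
Definition loss (N M : nat) (a : nat) z : R :=
  \sum_(q : 'I_M * bool) (1 - `|ramp (a + q.1 * N) ((-1) ^+ q.2 * z)|).

Lemma sum_pair_bool (N M : nat) (F : nat -> bool -> R) :
  \sum_(a < N) \sum_(q : 'I_M * bool) F (a + q.1 * N)%N q.2
  = \sum_(i < M * N) F i true + \sum_(i < M * N) F i false.
Proof.
rewrite -(sum_residues N M (F ^~ true)) -(sum_residues N M (F ^~ false)).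
rewrite -big_split; apply: eq_bigr => a _ /=.
rewrite -big_split -(pair_bigA _ (fun (i : 'I_M) (b : bool) => F (a + i * N)%N b)) /=.
by apply: eq_bigr => m _; rewrite big_bool.
Qed.

Lemma jump_ge0 N M a y z : 0 <= jump N M a y z.
Proof. exact: sumr_ge0. Qed.

Lemma jumpC N M a y z : jump N M a y z = jump N M a z y.
Proof. by apply: eq_bigr => q _; rewrite distrC. Qed.

Lemma sum_jump N M y z : \sum_(a < N) jump N M a y z <= 2 * `|y - z|.
Proof.
rewrite /jump (sum_pair_bool N M (fun i b =>
  `|ramp i ((-1) ^+ b * y) - ramp i ((-1) ^+ b * z)|)) !sum_dist_ramp.
rewrite !mulN1r !mul1r -mulrDr ler_wpM2l //.
have : 0 <= (M * N)%:R :> R by [].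
move: (_ * _)%:R => b b0.
wlog yz : y z / z <= y => [H|].
  have [yz|/ltW yz] := leP z y; first exact: H.
  by rewrite (distrC (clamp _ (- y))) (distrC (clamp _ y)) (distrC y) H.
have le1 := ler_clamp b0 yz.
have le2 : clamp b (- y) <= clamp b (- z) by apply: ler_clamp => //; lra.
rewrite distrC !ger0_norm ?subr_ge0 //.
by case: (clampP y b0) => -[? ->]; case: (clampP z b0) => -[? ->];
  case: (clampP (- y) b0) => -[? ->]; case: (clampP (- z) b0) => -[? ->]; lra.
Qed.

Lemma loss_ge0 N M a z : 0 <= loss N M a z.
Proof. by apply: sumr_ge0 => q _; rewrite subr_ge0 ramp_norm_le1. Qed.

Lemma sum_loss N M z : \sum_(a < N) loss N M a z <= 2.
Proof.
rewrite /loss (sum_pair_bool N M (fun i b => 1 - `|ramp i ((-1) ^+ b * z)|)).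
by rewrite -[2]/(1 + 1) lerD ?sum_ramp_loss.
Qed.

(** For nonnegative numbers the sum of the squares is at most the square of the
    sum. Hence a step from y to z, however long, has on average over the N
    residues a squared jump O((y - z)^2 / N). *)
Lemma sum_jump_sqr N M y z :
  \sum_(a < N) jump N M a y z ^+ 2 <= 4 * (y - z) ^+ 2.
Proof.
have S := sum_jump N M y z.
have -> : 4 * (y - z) ^+ 2 = (2 * `|y - z|) ^+ 2.
  by rewrite exprMn real_normK ?num_real //; lra.
apply: (@le_trans _ _ ((\sum_(a < N) jump N M a y z) ^+ 2)); last first.
  by apply: lerXn2r; rewrite ?nnegrE ?mulr_ge0 ?sumr_ge0 // => a _; exact: jump_ge0.
rewrite [leRHS]expr2 mulr_suml; apply: ler_sum => a _.
rewrite expr2 ler_wpM2l ?jump_ge0 // (bigD1 a) //= lerDl.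
by rewrite sumr_ge0 // => b _; exact: jump_ge0.
Qed.
End Ramps.

(** * Cutoffs in several coordinates *)
Lemma bigmin_dist_le (R : realType) (I : finType) (f g : I -> R) e :
  0 <= e -> (forall i, `|f i - g i| <= e) ->
  `|\big[Num.min/1]_i f i - \big[Num.min/1]_i g i| <= e.
Proof.
move=> e0 fg.
have key (u v : I -> R) : (forall i, `|u i - v i| <= e) ->
    \big[Num.min/1]_i u i - e <= \big[Num.min/1]_i v i.
  move=> uv; apply: le_bigmin => [|i _].
    by have := bigmin_le_id (index_enum I) 1 xpredT u; lra.
  by have := bigmin_le 1 i u; have := uv i; rewrite ler_norml; lra.
have k1 := key _ _ fg.
have k2 : \big[Num.min/1]_i g i - e <= \big[Num.min/1]_i f i.
  by apply: key => i; rewrite distrC.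
by rewrite ler_norml; lra.
Qed.

Section Cutoff.
Variables (R : realType) (k N M : nat) (a : 'I_k -> 'I_N).
Local Notation index := ('I_k * ('I_M * bool))%type.
Implicit Types (y z : 'I_k -> R) (p : index).

(* In coordinate j the walls have residue a j; the Boolean selects the walls or
   their opposites. *)
Let wall p : nat := a p.1 + p.2.1 * N.
Let arg z p : R := (-1) ^+ p.2.2 * z p.1.

Definition cutoff z : R := \big[Num.min/1]_p `|ramp (wall p) (arg z p)|.
Definition cell z : {ffun index -> bool} :=
  [ffun p => (wall p)%:R + 2^-1 < arg z p].
Definition opp_index p : index := (p.1, (p.2.1, ~~ p.2.2)).
Definition opp_cell (c : {ffun index -> bool}) : {ffun index -> bool} :=
  [ffun p => c (opp_index p)].
Definition jumps y z : R := \sum_j jump N M (a j) (y j) (z j) ^+ 2.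

Lemma opp_indexK : involutive opp_index.
Proof. by case=> j [m b]; rewrite /opp_index /= negbK. Qed.

Lemma opp_cellK : involutive opp_cell.
Proof. by move=> c; apply/ffunP => p; rewrite !ffunE opp_indexK. Qed.

Lemma arg_opp z p : arg (fun j => - z j) p = arg z (opp_index p).
Proof. by case: p => j [m []]; rewrite /arg /= ?expr1 ?expr0 ?mulN1r ?mul1r ?opprK. Qed.

Lemma cell_opp z : cell (fun j => - z j) = opp_cell (cell z).
Proof. by apply/ffunP => p; rewrite !ffunE arg_opp. Qed.

Lemma cutoff_opp z : cutoff (fun j => - z j) = cutoff z.
Proof.
rewrite /cutoff (reindex_inj (inv_inj opp_indexK)) /=.
by apply: eq_bigr => p _; rewrite arg_opp opp_indexK.
Qed.

Lemma cutoff_itv z : 0 <= cutoff z <= 1.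
Proof. by rewrite bigmin_le_id andbT; apply: le_bigmin. Qed.

Lemma cutoff_le z p : cutoff z <= `|ramp (wall p) (arg z p)|.
Proof. exact: bigmin_le. Qed.

Lemma jumps_ge0 y z : 0 <= jumps y z.
Proof. by apply: sumr_ge0 => j _; exact: sqr_ge0. Qed.

Lemma jumpsC y z : jumps y z = jumps z y.
Proof. by apply: eq_bigr => j _; rewrite jumpC. Qed.

Lemma ramp_dist_le y z p :
  `|ramp (wall p) (arg y p) - ramp (wall p) (arg z p)| ^+ 2 <= jumps y z.
Proof.
apply: (@le_trans _ _ (jump N M (a p.1) (y p.1) (z p.1) ^+ 2)).
  apply: lerXn2r; rewrite ?nnegrE ?jump_ge0 //.
  by rewrite /jump (bigD1 p.2) //= lerDl sumr_ge0.
by rewrite /jumps (bigD1 p.1) //= lerDl sumr_ge0 // => j _; exact: sqr_ge0.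
Qed.

Lemma cutoff_lip y z : (cutoff y - cutoff z) ^+ 2 <= jumps y z.
Proof.
have J0 := jumps_ge0 y z.
rewrite -(sqr_sqrtr J0) -(real_normK (num_real (_ - _))).
apply: lerXn2r; rewrite ?nnegrE ?sqrtr_ge0 //.
apply: bigmin_dist_le; rewrite ?sqrtr_ge0 // => p.
apply: (le_trans (ler_dist_dist _ _)).
rewrite -(ler_pXn2r (ltn0Sn 1)) ?nnegrE ?sqrtr_ge0 // sqr_sqrtr //.
exact: ramp_dist_le.
Qed.

(** Some wall separates y and z, and a step across it changes its ramp by at
    least the absolute value of the ramp at y. *)
Lemma cutoff_cell_neq y z : cell y != cell z -> cutoff y ^+ 2 <= jumps y z.
Proof.
move=> yz; have [p] : exists p, cell y p != cell z p.
  apply/existsP; apply: contraNT yz; rewrite negb_exists => /forallP yz.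
  by apply/eqP/ffunP => p; apply/eqP; have := yz p; rewrite negbK.
rewrite !ffunE => /ramp_separated sep.
apply: le_trans (ramp_dist_le y z p).
have /andP[c0 _] := cutoff_itv y.
by apply: lerXn2r; rewrite ?nnegrE // (le_trans (cutoff_le y p)).
Qed.

Lemma cutoff_loss z : 1 - cutoff z <= \sum_j loss N M (a j) (z j).
Proof.
rewrite lerBlDr -lerBlDl; apply: le_bigmin => [|p _].
  by rewrite gerBl sumr_ge0 // => j _; exact: loss_ge0.
rewrite lerBlDl -lerBlDr (bigD1 p.1) //= {1}/loss (bigD1 p.2) //= -addrA.
rewrite lerDl addr_ge0 ?sumr_ge0 // => q _; last exact: loss_ge0.
by rewrite subr_ge0 ramp_norm_le1.
Qed.

(** Consecutive walls are N apart, except that the innermost one and its opposite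
    may be almost 2N apart. *)
Lemma cell_eq_dist y z j : (0 < N)%N ->
  `|y j| <= (M * N)%:R -> `|z j| <= (M * N)%:R ->
  cell y = cell z -> `|y j - z j| <= 2 * N%:R.
Proof.
move=> N0.
have wallE (m : 'I_M) b : wall (j, (m, b)) = (a j + m * N)%N by [].
have aN : (a j)%:R + 1 <= N%:R :> R by rewrite natr1 ler_nat ltn_ord.
have a0 : 0 <= (a j)%:R :> R by [].
have N0' : 0 < N%:R :> R by rewrite ltr0n.
have key (u v : 'I_k -> R) : cell u = cell v -> 0 <= u j -> v j <= (M * N)%:R ->
    v j - u j <= 2 * N%:R.
  move=> cuv u0 vM; rewrite leNgt; apply/negP => uv.
  (* m N is the first multiple of N beyond u j; the wall between m N and (m+1) N
     would separate u from v *)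
  pose m := (Num.truncn (u j / N%:R)).+1.
  have := truncn_itv (divr_ge0 u0 (ltW N0')); rewrite -/m => /andP[m1 m2].
  have {}m1 : m%:R * N%:R <= u j + N%:R.
    by move: m1; rewrite /m -natr1 mulrDl mul1r lerD2r ler_pdivlMr.
  have {}m2 : u j < m%:R * N%:R by move: m2; rewrite ltr_pdivrMr.
  have mM : (m < M)%N.
    rewrite -(ltr_nat R) -(ltr_pM2r N0'); rewrite natrM in vM; lra.
  have := congr1 (fun c : {ffun _} => c (j, (Ordinal mM, false))) cuv.
  rewrite !ffunE /arg /= expr0 !mul1r wallE /= natrD natrM.
  have -> : (a j)%:R + m%:R * N%:R + 2^-1 < u j = false by apply/negbTE; rewrite -leNgt; lra.
  by have -> : (a j)%:R + m%:R * N%:R + 2^-1 < v j = true by lra.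
(* the innermost wall is at most N away from 0 *)
have key0 (u v : 'I_k -> R) : cell u = cell v -> u j <= 0 -> v j <= (M * N)%:R ->
    v j <= N%:R.
  move=> cuv u0 vM; rewrite leNgt; apply/negP => Nv.
  have M0 : (0 < M)%N.
    rewrite lt0n; apply: contraTneq Nv => M0.
    by rewrite -leNgt (le_trans vM) // M0 mul0n ler0n.
  have := congr1 (fun c : {ffun _} => c (j, (Ordinal M0, false))) cuv.
  rewrite !ffunE /arg /= expr0 !mul1r wallE /= mul0n addn0.
  have -> : (a j)%:R + 2^-1 < u j = false by apply/negbTE; rewrite -leNgt; lra.
  by have -> : (a j)%:R + 2^-1 < v j = true by lra.
wlog yz : y z / y j <= z j => [H hy hz c|].
  have [yz|/ltW yz] := leP (y j) (z j); first exact: H.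
  by rewrite distrC H.
move=> hy hz cyz; move: hy hz; rewrite [`|y j| <= _]ler_norml [`|z j| <= _]ler_norml.
move=> /andP[y1 y2] /andP[z1 z2].
have coz : cell (fun i => - z i) = cell (fun i => - y i) by rewrite !cell_opp cyz.
rewrite ler0_norm ?subr_le0 // opprB.
have [y0|y0] := leP 0 (y j); first exact: key.
have [z0|z0] := leP (z j) 0.
  have := key _ _ coz; rewrite oppr_ge0 opprK addrC; apply=> //; lra.
have := key0 _ _ cyz (ltW y0) z2.
have := key0 _ _ coz; rewrite oppr_le0 => /(_ (ltW z0)); lra.
Qed.
End Cutoff.

(** * Averaging and grouping *)

(** A set B of least cardinality among those of weight at least 1/2 has weight at
    most b: if one of its elements weighs at least 1/2, it is the only one; otherwise B
    minus an element weighs less than 1/2, and B less than 1. Splitting off B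
    therefore uses up at most b, and the argument can be repeated. *)
Lemma group_weights (R : realType) (I : finType) (w : I -> R) (b : R) (k : nat)
    (S : {set I}) :
  (forall i, 0 <= w i <= b) -> 1 <= b ->
  (k%:R - 1) * b + 2^-1 <= \sum_(i in S) w i ->
  exists A : 'I_k -> {set I},
    [/\ forall u v, u != v -> [disjoint A u & A v],
        forall u, A u \subset S
      & forall u, 2^-1 <= \sum_(i in A u) w i].
Proof.
move=> wb b1; have w0 i : 0 <= w i by case/andP: (wb i).
elim: k S => [|k IH] S hS.
  by exists (fun _ => finset.set0); split=> [[]|[]|[]].
pose heavy (B : {set I}) := (B \subset S) && (2^-1 <= \sum_(i in B) w i).
have hvS : heavy S.
  rewrite /heavy fintype.subxx /=; apply: le_trans hS; rewrite -[k.+1%:R]natr1 addrK.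
  by rewrite lerDr mulr_ge0 // (le_trans ler01).
case: (@arg_minnP _ S heavy (fun B => #|B|) hvS) => B /andP[BS Bw] Bmin.
have Bb : \sum_(i in B) w i <= b.
  have [->|/set0Pn[i iB]] := eqVneq B finset.set0.
    by rewrite big_set0 (le_trans ler01).
  have rest : \sum_(j in B :\ i) w j < 2^-1.
    rewrite ltNge; apply/negP => hw; have /Bmin : heavy (B :\ i).
      by rewrite /heavy hw (fintype.subset_trans (subD1set _ _)).
    by rewrite (cardsD1 i B) iB add1n ltnn.
  rewrite (big_setD1 i) //=.
  have [wi|wi] := leP (2^-1) (w i); last by lra.
  have /Bmin : heavy [set i].
    by rewrite /heavy big_set1 wi finset.sub1set (fintype.subsetP BS).
  rewrite cards1 (cardsD1 i B) iB add1n ltnS leqn0 cards_eq0 => /eqP ->.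
  by rewrite big_set0 addr0; case/andP: (wb i).
have [|A' [dA sA wA]] := IH (S :\: B).
  move: hS; rewrite (big_setID B) /= (finset.setIidPr BS) -[k.+1%:R]natr1; lra.
pose A (u : 'I_k.+1) := if unlift ord0 u is Some j then A' j else B.
have dB j : [disjoint B & A' j].
  rewrite disjoint_sym; rewrite disjoint_subset; apply/fintype.subsetP => x.
  by move=> /(fintype.subsetP (sA j)); rewrite finset.in_setD => /andP[].
exists A; split=> [u v|u|u]; rewrite /A.
- case: unliftP => [u'|] ->; case: unliftP => [v'|] -> //.
  + by rewrite (inj_eq lift_inj); apply: dA.
  + by move=> _; rewrite disjoint_sym.
- case: unliftP => [u' _|//].
  exact: fintype.subset_trans (sA u') (finset.subsetDl _ _).
- by case: unliftP.
Qed.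

Lemma exists_le_average (R : realType) (N : nat) (f : 'I_N -> R) : (0 < N)%N ->
  exists a, f a * N%:R <= \sum_b f b.
Proof.
case: N f => // N f _.
have [a _ amin] := Order.TotalTheory.arg_minP f (erefl (xpredT (ord0 : 'I_N.+1))).
exists a; rewrite mulr_natr -[N.+1 in leLHS]card_ord -sumr_const.
by apply: ler_sum => b _; exact: amin.
Qed.

(** Minimizing p/P + q/Q controls both terms at once; P = 0 or Q = 0 leaves only
    one of them to control. *)
Lemma exists_le_averages (R : realType) (N : nat) (p q : 'I_N -> R) (P Q : R) :
  (0 < N)%N -> (forall a, 0 <= p a) -> (forall a, 0 <= q a) ->
  \sum_a p a <= P -> \sum_a q a <= Q ->
  exists a, p a * N%:R <= 2 * P /\ q a * N%:R <= 2 * Q.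
Proof.
move=> N0 p0 q0 sp sq.
have P0 : 0 <= P by apply: le_trans sp; apply: sumr_ge0.
have Q0 : 0 <= Q by apply: le_trans sq; apply: sumr_ge0.
have zero (f : 'I_N -> R) : (forall a, 0 <= f a) -> \sum_a f a <= 0 -> forall a, f a = 0.
  move=> f0 sf a; apply/eqP; rewrite eq_le f0 andbT (le_trans _ sf) //.
  by rewrite (bigD1 a) //= lerDl sumr_ge0.
have [PZ|Pp] := eqVneq P 0.
  have [a ha] := exists_le_average q N0; exists a.
  have -> : p a = 0 by apply: zero => //; rewrite PZ in sp.
  by split; [rewrite mul0r mulr_ge0 | lra].
have [QZ|Qp] := eqVneq Q 0.
  have [a ha] := exists_le_average p N0; exists a.
  have -> : q a = 0 by apply: zero => //; rewrite QZ in sq.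
  by split; [lra | rewrite mul0r mulr_ge0].
have {}P0 : 0 < P by rewrite lt_def Pp.
have {}Q0 : 0 < Q by rewrite lt_def Qp.
have [a] := exists_le_average (fun a => p a / P + q a / Q) N0.
rewrite big_split /= -!mulr_suml => ha; exists a.
have h1 : (\sum_a p a) / P <= 1 by rewrite ler_pdivrMr ?mul1r.
have h2 : (\sum_a q a) / Q <= 1 by rewrite ler_pdivrMr ?mul1r.
have p1 : 0 <= p a / P * N%:R by rewrite !mulr_ge0 ?invr_ge0 // ltW.
have q1 : 0 <= q a / Q * N%:R by rewrite !mulr_ge0 ?invr_ge0 // ltW.
rewrite mulrDl in ha.
split; [rewrite -ler_pdivrMr // | rewrite -ler_pdivrMr //].
  by rewrite mulrAC; lra.
by rewrite mulrAC; lra.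
Qed.

Lemma exists_le_ratio (R : realType) (I : finType) (e m : I -> R) (B : R) :
  (forall i, 0 <= e i) -> (forall i, 0 <= m i) -> 0 < \sum_i m i ->
  \sum_i e i <= B * \sum_i m i -> exists2 i, 0 < m i & e i <= B * m i.
Proof.
move=> e0 m0 sm se; apply: contrapT => none.
have lti i : 0 < m i -> B * m i < e i.
  by move=> mi; rewrite ltNge; apply/negP => le; apply: none; exists i.
have [i mi] : exists i, 0 < m i.
  apply: contrapT => nomi; move: sm; rewrite big1 ?ltxx // => i _.
  by apply/eqP; rewrite eq_le m0 andbT leNgt; apply/negP => mi; apply: nomi; exists i.
move: se; rewrite leNgt => /negP; apply; rewrite mulr_sumr.
rewrite (bigD1 i) //= [ltRHS](bigD1 i) //= ltr_leD ?lti //.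
apply: ler_sum => j _; have := m0 j; rewrite le_eqVlt => /predU1P[<-|/lti/ltW//].
by rewrite mulr0.
Qed.

(** * Localization of orthonormal functions *)
Section Directions.
Variables (R : realType) (T : finType) (k : nat) (F : 'I_k -> T -> R).
Implicit Types (x y : T) (s : R).

(** The functions F_j are the coordinates of a map to R^k, used in polar
    coordinates. The direction is 0 where the map vanishes. *)
Definition radius x : R := Num.sqrt (\sum_j F j x ^+ 2).
Definition direction x (j : 'I_k) : R := F j x / radius x.

Lemma radius_sqr x : radius x ^+ 2 = \sum_j F j x ^+ 2.
Proof. by rewrite sqr_sqrtr // sumr_ge0 // => j _; exact: sqr_ge0. Qed.

Lemma radius_ge0 x : 0 <= radius x. Proof. exact: sqrtr_ge0. Qed.

Lemma radius_direction x j : F j x = radius x * direction x j.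
Proof.
have [r0|r0] := eqVneq (radius x) 0; last by rewrite mulrC divfK.
rewrite r0 mul0r; apply/eqP; rewrite -sqrf_eq0 eq_le sqr_ge0 andbT.
apply: (@le_trans _ _ (\sum_i F i x ^+ 2)); last by rewrite -radius_sqr r0 expr0n.
by rewrite (bigD1 j) //= lerDl sumr_ge0 // => i _; exact: sqr_ge0.
Qed.

Lemma sum_direction_sqr x : radius x != 0 -> \sum_j direction x j ^+ 2 = 1.
Proof.
move=> r0; under eq_bigr do rewrite expr_div_n.
by rewrite -mulr_suml -radius_sqr divff // sqrf_eq0.
Qed.

Lemma sum_direction_sqr_le x : \sum_j direction x j ^+ 2 <= 1.
Proof.
have [r0|r0] := eqVneq (radius x) 0; last by rewrite sum_direction_sqr.
by rewrite big1 // => j _; rewrite /direction r0 invr0 mulr0 expr0n.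
Qed.

Lemma direction_le1 x j : `|direction x j| <= 1.
Proof.
rewrite -(ler_pXn2r (ltn0Sn 1)) ?nnegrE // expr1n real_normK ?num_real //.
apply: le_trans (sum_direction_sqr_le x).
by rewrite (bigD1 j) //= lerDl sumr_ge0 // => i _; exact: sqr_ge0.
Qed.

Lemma radius_lip x y s : s ^+ 2 = 1 ->
  (radius x - radius y) ^+ 2 <= \sum_j (F j x - s * F j y) ^+ 2.
Proof.
move=> s2; set c := \sum_j F j x * F j y.
have -> : \sum_j (F j x - s * F j y) ^+ 2 = radius x ^+ 2 + radius y ^+ 2 - 2 * (s * c).
  rewrite !radius_sqr /c !mulr_sumr -sumrN -!big_split; apply: eq_bigr => j _ /=.
  have -> : F j y ^+ 2 = s ^+ 2 * F j y ^+ 2 by rewrite s2 mul1r.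
  by ring.
have CS : c ^+ 2 <= (radius x * radius y) ^+ 2.
  have := @sum_CauchySchwarz R _ (fun=> 1) (F ^~ x) (F ^~ y) (fun=> ler01).
  by under eq_bigr do rewrite mul1r; under [X in _ <= X * _]eq_bigr do rewrite mul1r;
    under [X in _ <= _ * X]eq_bigr do rewrite mul1r; rewrite -!radius_sqr exprMn.
have : s * c <= radius x * radius y.
  apply: le_trans (ler_norm _) _.
  rewrite -(ler_pXn2r (ltn0Sn 1)) ?nnegrE ?mulr_ge0 ?radius_ge0 //.
  by rewrite real_normK ?num_real // exprMn s2 mul1r.
by rewrite sqrrB; lra.
Qed.

(** The vectors radius x * (direction x - s direction y) and F(x) - s F(y) differ
    by s (radius x - radius y) direction y, which [radius_lip] controls. *)
Lemma direction_dist x y s : s ^+ 2 = 1 ->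
  radius x ^+ 2 * \sum_j (direction x j - s * direction y j) ^+ 2
    <= 4 * \sum_j (F j x - s * F j y) ^+ 2.
Proof.
move=> s2; have rl := radius_lip x y s2.
apply: (@le_trans _ _ (2 * \sum_j (F j x - s * F j y) ^+ 2
    + 2 * (radius x - radius y) ^+ 2 * \sum_j direction y j ^+ 2)); last first.
  have : 2 * (radius x - radius y) ^+ 2 * \sum_j direction y j ^+ 2
      <= 2 * (radius x - radius y) ^+ 2.
    by rewrite ler_piMr ?sum_direction_sqr_le // mulr_ge0 ?sqr_ge0.
  by lra.
rewrite !mulr_sumr -big_split; apply: ler_sum => j _ /=.
rewrite (radius_direction x j) (radius_direction y j).
set p := radius x * direction x j - s * (radius y * direction y j).
set q := (radius x - radius y) * direction y j.
have -> : radius x ^+ 2 * (direction x j - s * direction y j) ^+ 2 = (p - s * q) ^+ 2.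
  by rewrite /p /q; ring.
have -> : 2 * (radius x - radius y) ^+ 2 * direction y j ^+ 2 = 2 * (s * q) ^+ 2.
  by rewrite (_ : (s * q) ^+ 2 = s ^+ 2 * q ^+ 2) ?exprMn // s2 /q; ring.
by have := sqr_ge0 (p + s * q); lra.
Qed.
End Directions.

Section Localization.
Variables (R : realType) (T : finType) (G : signed_graph R T).
Local Notation weight := (weight G).
Local Notation esign := (esign G).
Local Notation vmass := (vmass G).
Variables (k N M : nat) (F : 'I_k -> T -> R).
Hypothesis N0 : (0 < N)%N.
Local Notation W := ((M * N)%:R : R).
Local Notation radius := (radius F).
Local Notation direction := (direction F).
Implicit Types (x y : T).

(** The scaling makes the walls, which reach up to W, cover all directions;
    [signed_pos] is the position that an edge of small energy brings close to
    that of x. *)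
Definition grid_pos x (j : 'I_k) : R := W * direction x j.
Definition signed_pos x y (j : 'I_k) : R := esign x y * grid_pos y j.

Lemma grid_pos_le x j : `|grid_pos x j| <= W.
Proof. by rewrite normrM normr_nat ler_piMr ?ler0n // direction_le1. Qed.

Lemma grid_pos_dist x y :
  (radius x ^+ 2 + radius y ^+ 2) * \sum_j (grid_pos x j - signed_pos x y j) ^+ 2
    <= 8 * W ^+ 2 * \sum_j (F j x - esign x y * F j y) ^+ 2.
Proof.
have s2 := esign_sqr G x y.
have -> : \sum_j (grid_pos x j - signed_pos x y j) ^+ 2
    = W ^+ 2 * \sum_j (direction x j - esign x y * direction y j) ^+ 2.
  by rewrite mulr_sumr; apply: eq_bigr => j _; rewrite /signed_pos /grid_pos; ring.
have flip (u v : 'I_k -> R) :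
    \sum_j (u j - esign x y * v j) ^+ 2 = \sum_j (v j - esign x y * u j) ^+ 2.
  apply: eq_bigr => j _.
  transitivity (u j ^+ 2 + esign x y ^+ 2 * v j ^+ 2 - 2 * (esign x y * u j * v j)).
    by ring.
  have -> : u j ^+ 2 = esign x y ^+ 2 * u j ^+ 2 by rewrite s2 mul1r.
  by rewrite s2 mul1r; ring: s2.
have h1 := direction_dist F x y s2.
have h2 : radius y ^+ 2 * \sum_j (direction x j - esign x y * direction y j) ^+ 2
    <= 4 * \sum_j (F j x - esign x y * F j y) ^+ 2.
  by rewrite flip [X in _ <= _ * X](flip (F ^~ x) (F ^~ y)); exact: direction_dist.
rewrite mulrCA mulrDl [leRHS]mulrAC [leRHS]mulrC ler_wpM2l ?sqr_ge0 //.
by lra.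
Qed.

(** Summed over the N residues, the mass lost at the walls of a coordinate is at
    most twice the total mass, and the energy caused by the cutoff in this
    coordinate is bounded independently of N. Both costs of the cutoff are sums
    over the coordinates, so a good residue can be chosen in each coordinate
    separately. *)
Lemma exists_walls : exists a : 'I_k -> 'I_N,
  (\sum_x vmass x * (radius x ^+ 2 * (1 - cutoff M a (grid_pos x) ^+ 2))) * N%:R
     <= 8 * k%:R * \sum_x vmass x * radius x ^+ 2
  /\ (2^-1 * \sum_x \sum_y weight x y *
       ((radius x ^+ 2 + radius y ^+ 2) * jumps M a (grid_pos x) (signed_pos x y))) * N%:R
     <= 64 * W ^+ 2 * \sum_j energy G (F j).
Proof.
pose lost j (a : 'I_N) := \sum_x vmass x * radius x ^+ 2 * loss N M a (grid_pos x j).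
pose c x y := weight x y * (radius x ^+ 2 + radius y ^+ 2).
pose cost j (a : 'I_N) :=
  2^-1 * \sum_x \sum_y c x y * jump N M a (grid_pos x j) (signed_pos x y j) ^+ 2.
pose K := \sum_x vmass x * radius x ^+ 2.
pose Q j := 2^-1 * \sum_x \sum_y c x y * (4 * (grid_pos x j - signed_pos x y j) ^+ 2).
have m0 x : 0 <= vmass x by rewrite ltW ?vmass_gt0.
have c0 x y : 0 <= c x y by rewrite mulr_ge0 ?weight_ge0 // addr_ge0 ?sqr_ge0.
have ex j : exists a : 'I_N,
    lost j a * N%:R <= 2 * (2 * K) /\ cost j a * N%:R <= 2 * Q j.
  apply: exists_le_averages => //.
  - move=> a; apply: sumr_ge0 => x _.
    by rewrite mulr_ge0 ?loss_ge0 // mulr_ge0 ?sqr_ge0.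
  - move=> a; rewrite mulr_ge0 ?invr_ge0 // sumr_ge0 // => x _.
    by rewrite sumr_ge0 // => y _; rewrite mulr_ge0 ?sqr_ge0.
  - rewrite exchange_big /= mulr_sumr; apply: ler_sum => x _.
    by rewrite -mulr_sumr mulrC ler_wpM2r ?sum_loss // mulr_ge0 ?sqr_ge0.
  rewrite -mulr_sumr ler_wpM2l ?invr_ge0 // exchange_big /=.
  apply: ler_sum => x _; rewrite exchange_big /=; apply: ler_sum => y _.
  by rewrite -mulr_sumr ler_wpM2l // sum_jump_sqr.
have /choice [a ha] := ex; exists a; split.
  apply: (@le_trans _ _ (2 * (\sum_j lost j (a j)) * N%:R)).
    rewrite ler_wpM2r // /lost exchange_big /= mulr_sumr; apply: ler_sum => x _.
    rewrite -mulr_sumr mulrA [leRHS]mulrCA.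
    apply: ler_wpM2l; first by rewrite mulr_ge0 ?sqr_ge0.
    have h1 := cutoff_loss M a (grid_pos x); have /andP[h2 h3] := cutoff_itv M a (grid_pos x).
    by apply: le_trans (ler_wpM2l _ h1) => //; nra.
  have : \sum_j lost j (a j) * N%:R <= \sum_(j < k) 4 * K.
    by apply: ler_sum => j _; have [h _] := ha j; lra.
  by rewrite sumr_const card_ord -[_ *+ k]mulr_natl -mulr_suml /K; lra.
have -> : 2^-1 * \sum_x \sum_y weight x y *
       ((radius x ^+ 2 + radius y ^+ 2) * jumps M a (grid_pos x) (signed_pos x y))
    = \sum_j cost j (a j).
  rewrite /cost -mulr_sumr [X in _ = _ * X]exchange_big /=; congr (_ * _).
  apply: eq_bigr => x _; rewrite [RHS]exchange_big /=; apply: eq_bigr => y _.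
  by rewrite -mulr_sumr mulrA.
apply: (@le_trans _ _ (\sum_j 2 * Q j)).
  by rewrite mulr_suml; apply: ler_sum => j _; case: (ha j).
rewrite -mulr_sumr /Q -mulr_sumr /energy -mulr_sumr.
have : \sum_x \sum_j \sum_y c x y * (4 * (grid_pos x j - signed_pos x y j) ^+ 2)
    <= \sum_x \sum_j \sum_y 32 * W ^+ 2 * (weight x y * (F j x - esign x y * F j y) ^+ 2).
  apply: ler_sum => x _; rewrite exchange_big [leRHS]exchange_big /=.
  apply: ler_sum => y _; rewrite -!mulr_sumr /c.
  have := ler_wpM2l (weight_ge0 G x y) (grid_pos_dist x y); lra.
under [X in _ <= X -> _]eq_bigr do (under eq_bigr do rewrite -mulr_sumr; rewrite -mulr_sumr).
rewrite -mulr_sumr [X in X <= _ -> _]exchange_big [X in _ <= _ * X -> _]exchange_big /=.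
by lra.
Qed.
End Localization.

Section Clusters.
Variables (R : realType) (T : finType) (G : signed_graph R T).
Local Notation weight := (weight G).
Local Notation esign := (esign G).
Local Notation vmass := (vmass G).
Variables (k N M : nat) (F : 'I_k -> T -> R) (a : 'I_k -> 'I_N).
Local Notation radius := (radius F).
Local Notation direction := (direction F).
Local Notation grid_pos := (grid_pos N M F).
Local Notation signed_pos := (signed_pos G N M F).
Local Notation labels := {set {ffun 'I_k * ('I_M * bool) -> bool}}.
Implicit Types (x y : T) (A : {set labels}).

(** Opposite cells have the same label, since an edge determines F only up to
    sign. *)
Definition label x := [set cell M a (grid_pos x); opp_cell (cell M a (grid_pos x))].
Definition cluster_cutoff A x : R := (label x \in A)%:R * cutoff M a (grid_pos x).

Lemma signed_pos_cases x y :
  signed_pos x y = grid_pos y \/ signed_pos x y = (fun j => - grid_pos y j).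
Proof.
have [s1|s1] := esign_pm1 G x y; [left|right]; apply/funext => j;
  by rewrite /signed_pos s1 ?mul1r ?mulN1r.
Qed.

Lemma cutoff_signed_pos x y : cutoff M a (signed_pos x y) = cutoff M a (grid_pos y).
Proof. by case: (signed_pos_cases x y) => ->; rewrite ?cutoff_opp. Qed.

Lemma label_neq x y :
  label x != label y -> cell M a (grid_pos x) != cell M a (signed_pos x y).
Proof.
apply: contraNneq; rewrite /label.
case: (signed_pos_cases x y) => -> ->; first by [].
by rewrite cell_opp opp_cellK finset.setUC.
Qed.

(** Inside a label this is the Lipschitz bound of the cutoff; between different
    labels there is a wall, and the cutoff itself is small. *)
Lemma cluster_cutoff_lip A x y :
  (cluster_cutoff A x - cluster_cutoff A y) ^+ 2
    <= jumps M a (grid_pos x) (signed_pos x y).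
Proof.
have J0 := jumps_ge0 M a (grid_pos x) (signed_pos x y).
rewrite /cluster_cutoff -(cutoff_signed_pos x y).
have [eqL|/label_neq neL] := eqVneq (label x) (label y).
  rewrite eqL -mulrBr; case: (_ \in _); last by rewrite mul0r expr0n.
  by rewrite mul1r cutoff_lip.
have hx := cutoff_cell_neq neL.
have hy : cutoff M a (signed_pos x y) ^+ 2 <= jumps M a (grid_pos x) (signed_pos x y).
  by rewrite jumpsC; apply: cutoff_cell_neq; rewrite eq_sym.
case: (_ \in _); case: (_ \in _); rewrite ?mul1r ?mul0r ?subr0 ?sub0r ?sqrrN ?expr0n //.
exact: cutoff_lip.
Qed.

Lemma cluster_cutoff_itv A x : 0 <= cluster_cutoff A x <= 1.
Proof.
rewrite /cluster_cutoff; case: (_ \in _); last by rewrite mul0r lexx ler01.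
by rewrite mul1r cutoff_itv.
Qed.

(** The product rule: al F(x) - sg be F(y) is the sum of al (F(x) - sg F(y)) and
    sg (al - be) F(y), for al and be the values of the cutoff at x and y. *)
Lemma cluster_cutoff_energy A :
  \sum_j energy G (fun x => cluster_cutoff A x * F j x) <=
  2 * \sum_j energy G (F j) + 2 * (2^-1 * \sum_x \sum_y weight x y *
       ((radius x ^+ 2 + radius y ^+ 2) * jumps M a (grid_pos x) (signed_pos x y))).
Proof.
rewrite /energy -!mulr_sumr mulrCA [X in _ <= _ + X]mulrCA -mulrDr ler_wpM2l ?invr_ge0 //.
rewrite exchange_big [X in _ <= _ * X + _]exchange_big /= !mulr_sumr -big_split.
apply: ler_sum => x _; rewrite exchange_big [X in _ <= _ * X + _]exchange_big /=.
rewrite !mulr_sumr -big_split; apply: ler_sum => y _ /=.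
rewrite -!mulr_sumr mulrCA [X in _ <= _ + X]mulrCA -mulrDr ler_wpM2l ?weight_ge0 //.
have L := cluster_cutoff_lip A x y; have /andP[b0 b1] := cluster_cutoff_itv A x.
set al := cluster_cutoff A x in L b0 b1 *; set be := cluster_cutoff A y in L *.
apply: (@le_trans _ _ (\sum_j (2 * (F j x - esign x y * F j y) ^+ 2
                              + 2 * (al - be) ^+ 2 * F j y ^+ 2))).
  apply: ler_sum => j _.
  set p := F j x - esign x y * F j y; set q := esign x y * ((al - be) * F j y).
  have -> : al * F j x - esign x y * (be * F j y) = al * p + q by rewrite /p /q; ring.
  have -> : 2 * (al - be) ^+ 2 * F j y ^+ 2 = 2 * q ^+ 2.
    have -> : q ^+ 2 = esign x y ^+ 2 * ((al - be) * F j y) ^+ 2 by rewrite /q; ring.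
    by rewrite esign_sqr; ring.
  have h1 := sqr_ge0 (al * p - q).
  have h2 : al ^+ 2 * p ^+ 2 <= p ^+ 2.
    by rewrite ler_piMl ?sqr_ge0 // exprn_ile1.
  by lra.
rewrite big_split /= -!mulr_sumr -radius_sqr lerD2l.
set J := jumps _ _ _ _ in L *; set rx := radius x ^+ 2; set ry := radius y ^+ 2.
have h1 : (al - be) ^+ 2 * ry <= J * ry by rewrite ler_wpM2r ?sqr_ge0.
have h2 : 0 <= J * rx by rewrite mulr_ge0 ?sqr_ge0 ?jumps_ge0.
by lra.
Qed.

Lemma label_eq_dist x y : (0 < N)%N -> label x = label y ->
  exists2 e : R, e ^+ 2 = 1 & forall j, `|grid_pos x j - e * grid_pos y j| <= 2 * N%:R.
Proof.
move=> N0 eqL.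
have : cell M a (grid_pos x) \in label y by rewrite -eqL !inE eqxx.
rewrite !inE => /orP[/eqP c|/eqP c].
  exists 1; rewrite ?expr1n // => j; rewrite mul1r.
  exact: cell_eq_dist N0 (grid_pos_le _ _ _ _ _) (grid_pos_le _ _ _ _ _) c.
exists (-1); rewrite ?sqrrN ?expr1n // => j; rewrite mulN1r.
apply: (cell_eq_dist (M := M) (a := a) (y := grid_pos x)
  (z := fun i => - grid_pos y i) (j := j) N0 _ _ _) => /=.
- exact: grid_pos_le.
- by rewrite normrN grid_pos_le.
- by rewrite cell_opp.
Qed.
End Clusters.

Section Isotropic.
Variables (R : realType) (T : finType) (G : signed_graph R T).
Local Notation vmass := (vmass G).
Variables (k : nat) (F : 'I_k -> T -> R).
Hypothesis orthoF : forall i j, inner G (F i) (F j) = (i == j)%:R.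

Lemma sum_radius_sqr : \sum_x vmass x * radius F x ^+ 2 = k%:R.
Proof.
under eq_bigr do rewrite radius_sqr mulr_sumr.
rewrite exchange_big /= (eq_bigr (fun=> 1)); first by rewrite sumr_const card_ord.
move=> j _; transitivity (inner G (F j) (F j)); last by rewrite orthoF eqxx.
by apply: eq_bigr => x _; rewrite expr2.
Qed.

Lemma isotropy (u : 'I_k -> R) :
  \sum_x vmass x * (\sum_j u j * F j x) ^+ 2 = \sum_j u j ^+ 2.
Proof.
transitivity (\sum_i \sum_j u i * u j * inner G (F i) (F j)).
  under [RHS]eq_bigr do (under eq_bigr do rewrite mulr_sumr; rewrite exchange_big).
  rewrite [RHS]exchange_big; apply: eq_bigr => x _ /=.
  rewrite expr2 mulr_suml mulr_sumr; apply: eq_bigr => i _.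
  rewrite !mulr_sumr; apply: eq_bigr => j _; ring.
apply: eq_bigr => i _; rewrite (bigD1 i) //= orthoF eqxx mulr1 big1 ?addr0 ?expr2 //.
by move=> j ji; rewrite orthoF eq_sym (negbTE ji) mulr0.
Qed.

(** Isotropy in the direction u of x0: the sum of vmass x * <u, F(x)>^2 over all
    x is 1, and every x that is aligned with x0 up to sign contributes at least
    (1 - 2 d) vmass x |F(x)|^2 to it. *)
Lemma aligned_mass (P : pred T) x0 (d : R) : d <= 2^-1 -> radius F x0 != 0 ->
  (forall x, P x -> exists2 e : R, e ^+ 2 = 1 &
      \sum_j (direction F x j - e * direction F x0 j) ^+ 2 <= 2 * d) ->
  (1 - 2 * d) * \sum_(x | P x) vmass x * radius F x ^+ 2 <= 1.
Proof.
move=> d2 r0 aligned.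
rewrite -[X in _ <= X](sum_direction_sqr r0) -isotropy mulr_sumr big_mkcond /=.
apply: ler_sum => x _; case: ifP => [/aligned [e e2 he]|_]; last first.
  by rewrite mulr_ge0 ?sqr_ge0 // ltW ?vmass_gt0.
rewrite mulrCA ler_wpM2l ?(ltW (vmass_gt0 _ _)) //.
have -> : \sum_j direction F x0 j * F j x
    = radius F x * \sum_j direction F x0 j * direction F x j.
  by rewrite mulr_sumr; apply: eq_bigr => j _; rewrite [in LHS]radius_direction; ring.
rewrite exprMn [leLHS]mulrC; have [rx|rx] := eqVneq (radius F x) 0.
  by rewrite rx expr0n /= !mul0r.
apply: ler_wpM2l; first exact: sqr_ge0.
set c := \sum_j _.
have hc : \sum_j (direction F x j - e * direction F x0 j) ^+ 2 = 2 - 2 * (e * c).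
  have -> : 2 - 2 * (e * c) = \sum_j direction F x j ^+ 2
      + e ^+ 2 * \sum_j direction F x0 j ^+ 2 - 2 * (e * c).
    by rewrite !sum_direction_sqr // e2 mulr1.
  rewrite /c !mulr_sumr -sumrN -!big_split; apply: eq_bigr => j _ /=; ring.
have ec : 1 - d <= e * c by rewrite hc in he; lra.
have -> : c ^+ 2 = (e * c) ^+ 2 by rewrite exprMn e2 mul1r.
have d1 : 0 <= 1 - d by lra.
have : (1 - d) ^+ 2 <= (e * c) ^+ 2.
  by apply: lerXn2r; rewrite ?nnegrE // (le_trans d1).
by have := sqr_ge0 d; lra.
Qed.
End Isotropic.

Section LocalizationTheorem.
Variables (R : realType) (T : finType) (G : signed_graph R T).
Local Notation vmass := (vmass G).
Variables (k : nat) (F : 'I_k -> T -> R).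
Hypothesis k0 : (0 < k)%N.
Hypothesis orthoF : forall i j, inner G (F i) (F j) = (i == j)%:R.

(* With N = 32 k^2 residues, the walls destroy at most 1/4 of the total mass k;
   with M = 6 k walls of each residue, a cell has width 2/M = 1/(3 k) in every
   coordinate, and so squared diameter 1/(9 k). *)
Let N := (32 * k ^ 2)%N.
Let M := (6 * k)%N.

(** An instance of [aligned_mass] with 2 d = 1/(9 k); the bound follows from
    (1 - 1/(9 k)) (1 + 1/(8 k)) >= 1. *)
Lemma label_mass_le (a : 'I_k -> 'I_N) l :
  \sum_(x | label M F a x == l) vmass x * radius F x ^+ 2 <= 1 + (8 * k%:R)^-1.
Proof.
have kp : 0 < k%:R :> R by rewrite ltr0n.
have k1 : 1 <= k%:R :> R by rewrite ler1n.
have N0 : (0 < N)%N by rewrite /N muln_gt0 expn_gt0 k0.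
have NR : 0 < N%:R :> R by rewrite ltr0n.
set t : R := k%:R^-1.
have t0 : 0 < t by rewrite invr_gt0.
have t1 : t <= 1 by rewrite invf_le1.
have kt : k%:R * t = 1 by rewrite mulfV ?gt_eqF.
have -> : (8 * k%:R)^-1 = t / 8 by rewrite invfM mulrC.
have [[x0 /andP[/eqP lx0 r0]]|none] :=
  pselect (exists x, (label M F a x == l) && (radius F x != 0)); last first.
  rewrite big1 ?addr_ge0 ?divr_ge0 // ?ltW // => x lx.
  have [->|rx] := eqVneq (radius F x) 0; first by rewrite expr0n mulr0.
  by case: none; exists x; rewrite lx.
set S := \sum_(x | _) _.
have S0 : 0 <= S by apply: sumr_ge0 => x _; rewrite mulr_ge0 ?sqr_ge0 // ltW ?vmass_gt0.
suff : (1 - 2 * (t / 18)) * S <= 1 by nra.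
apply: (aligned_mass orthoF _ r0) => [|x /eqP lx]; first by lra.
have [|e e2 he] := @label_eq_dist R T k N M F a x x0 N0; first by rewrite lx lx0.
exists e => //.
have hj j : (direction F x j - e * direction F x0 j) ^+ 2 <= t ^+ 2 / 9.
    have := he j; rewrite /grid_pos.
    have -> : (M * N)%:R * direction F x j - e * ((M * N)%:R * direction F x0 j)
        = 2 * N%:R * (3 * k%:R * (direction F x j - e * direction F x0 j)) :> R.
      by rewrite /M !natrM; ring.
    rewrite normrM (@ger0_norm _ (2 * _)) ?mulr_ge0 // ger_pMr ?mulr_gt0 //.
    rewrite normrM (@ger0_norm _ (3 * _)) ?mulr_ge0 // => h.
    have h' : `|direction F x j - e * direction F x0 j| <= t / 3.
      by rewrite -(ler_pM2l kp) [leRHS]mulrA kt; lra.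
    rewrite -(real_normK (num_real (_ - _))).
    have -> : t ^+ 2 / 9 = (t / 3) ^+ 2 by field.
    by apply: lerXn2r; rewrite ?nnegrE ?divr_ge0 // ltW.
  apply: (le_trans (ler_sum _ (fun j _ => hj j))).
  rewrite sumr_const card_ord -[_ *+ k]mulr_natl.
  have -> : k%:R * (t ^+ 2 / 9) = (k%:R * t) * t / 9 by ring.
  by rewrite kt; lra.
Qed.

(** The restriction of the cut-off map F to a group of labels has squared norm at
    least 1/2 and energy O(k^4) times that of F. Both are sums over the k
    coordinates, so some coordinate has a quotient that is no worse. *)
Theorem localization : exists g : 'I_k -> T -> R,
  [/\ forall i, 0 < inner G (g i) (g i),
      forall i j x, i != j -> g i x != 0 -> g j x = 0
    & forall i, energy G (g i) <=
        (40 * 2 ^+ 13) * k%:R ^+ 4 * (\sum_j energy G (F j)) * inner G (g i) (g i)].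
Proof.
have kp : 0 < k%:R :> R by rewrite ltr0n.
have k1 : 1 <= k%:R :> R by rewrite ler1n.
have N0 : (0 < N)%N by rewrite /N muln_gt0 expn_gt0 k0.
have NR : 0 < N%:R :> R by rewrite ltr0n.
have NE : N%:R = 32 * k%:R ^+ 2 :> R by rewrite /N natrM natrX.
have [a [lost cost]] := exists_walls G M F N0.
set E := \sum_j energy G (F j) in cost *.
have E0 : 0 <= E by apply: sumr_ge0 => j _; exact: energy_ge0.
set L := \sum_x _ in lost; set C := 2^-1 * _ in cost.
rewrite (sum_radius_sqr orthoF) in lost.
have {}lost : L <= 1 / 4.
  rewrite -(ler_pM2r NR); apply: (le_trans lost).
  by rewrite NE; lra.
have {}cost : C <= 9 * 2 ^+ 13 * k%:R ^+ 4 * E.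
  rewrite -(ler_pM2r NR); apply: (le_trans cost).
  rewrite natrM NE /M natrM le_eqVlt; apply/orP; left; apply/eqP; ring.
pose w l := \sum_(x | label M F a x == l)
  vmass x * (radius F x ^+ 2 * cutoff M a (grid_pos N M F x) ^+ 2).
have m0 x : 0 <= vmass x by rewrite ltW ?vmass_gt0.
have w0 l : 0 <= w l.
  by apply: sumr_ge0 => x _; rewrite mulr_ge0 // mulr_ge0 ?sqr_ge0.
have wb l : 0 <= w l <= 1 + (8 * k%:R)^-1.
  rewrite w0 /=; apply: le_trans (label_mass_le a l).
  apply: ler_sum => x _; rewrite ler_wpM2l // ler_piMr ?sqr_ge0 //.
  by have /andP[c0 c1] := cutoff_itv M a (grid_pos N M F x); rewrite exprn_ile1.
have wtot : \sum_l w l = k%:R - L.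
  rewrite -(sum_radius_sqr orthoF) -sumrB.
  rewrite [RHS](partition_big (label M F a) xpredT) //=.
  by apply: eq_bigr => l _; apply: eq_bigr => x _; ring.
(* a total of at least k - 1/4 suffices for k groups of weight 1/2, as
   (k - 1) (1 + 1/(8 k)) + 1/2 <= k - 3/8 *)
have [||A [dA _ wA]] := @group_weights R _ w (1 + (8 * k%:R)^-1) k finset.setT wb.
- by rewrite lerDl invr_ge0 mulr_ge0.
- rewrite (eq_bigl xpredT) => [|l]; last by rewrite finset.in_setT.
  rewrite wtot.
  have -> : (k%:R - 1) * (1 + (8 * k%:R)^-1) = k%:R - 1 + (1 - k%:R^-1) / 8 :> R.
    by field; rewrite gt_eqF.
  have : 0 < k%:R^-1 :> R by rewrite invr_gt0.
  lra.
pose h i j x := cluster_cutoff F a (A i) x * F j x.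
have ex i : exists2 j, 0 < inner G (h i j) (h i j) &
    energy G (h i j) <= (40 * 2 ^+ 13) * k%:R ^+ 4 * E * inner G (h i j) (h i j).
  have mh : 2^-1 <= \sum_j inner G (h i j) (h i j).
    apply: (le_trans (wA i)); rewrite exchange_big /=.
    rewrite [leRHS](partition_big (label M F a) xpredT) //= big_mkcond /=.
    apply: ler_sum => l _; case: ifP => lA; last first.
      by apply: sumr_ge0 => x _; apply: sumr_ge0 => j _; rewrite mulr_ge0 // -expr2 sqr_ge0.
    rewrite /w; apply: ler_sum => x /eqP lx.
    rewrite radius_sqr mulr_suml mulr_sumr; apply: ler_sum => j _.
    rewrite ler_wpM2l // /h /cluster_cutoff lx lA mul1r le_eqVlt; apply/orP; left; apply/eqP; ring.
  apply: exists_le_ratio => [j|j||].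
  - exact: energy_ge0.
  - exact: inner_ge0.
  - by apply: lt_le_trans mh; lra.
  apply: (le_trans (cluster_cutoff_energy G F a (A i))); rewrite -/E -/C.
  have k4 : 1 <= k%:R ^+ 4 :> R by rewrite exprn_ege1.
  have kE : E <= k%:R ^+ 4 * E by rewrite ler_peMl.
  have kE0 : 0 <= k%:R ^+ 4 * E by apply: le_trans kE.
  have c1 : 1 <= 2 ^+ 13 :> R by rewrite exprn_ege1 // ler1n.
  have cX : k%:R ^+ 4 * E <= 2 ^+ 13 * (k%:R ^+ 4 * E) by rewrite ler_peMl.
  apply: (@le_trans _ _ ((40 * 2 ^+ 13) * k%:R ^+ 4 * E * 2^-1)).
    by move: cX cost; move: (2 ^+ 13) => c; lra.
  by rewrite ler_wpM2l // -mulrA mulr_ge0 // mulr_ge0 // (le_trans _ c1).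
have /choice [J hJ] : forall i, exists j, 0 < inner G (h i j) (h i j) /\
    energy G (h i j) <= (40 * 2 ^+ 13) * k%:R ^+ 4 * E * inner G (h i j) (h i j).
  by move=> i; have [j] := ex i; exists j.
exists (fun i => h i (J i)); split=> [i|i j x ij|i]; [by case: (hJ i)| |by case: (hJ i)].
rewrite /h /cluster_cutoff; have [lA|] := boolP (label M F a x \in A i); last by rewrite !mul0r eqxx.
by rewrite (disjointFr (dA i j ij) lA) !mul0r.
Qed.
End LocalizationTheorem.

(** * Diagonalization of symmetric matrices *)
Lemma char_poly_similar (R : comNzRingType) n (P Q A : 'M[R]_n) :
  P *m Q = 1%:M -> char_poly (P *m A *m Q) = char_poly A.
Proof.
move=> PQ; rewrite /char_poly.
have PQX : map_mx polyC P *m map_mx polyC Q = 1%:M.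
  by rewrite -map_mxM PQ map_scalar_mx.
have -> : char_poly_mx (P *m A *m Q) = map_mx polyC P *m char_poly_mx A *m map_mx polyC Q.
  rewrite /char_poly_mx mulmxBr mulmxBl !map_mxM; congr (_ - _).
  by rewrite scalar_mxC -mulmxA PQX mulmx1.
by rewrite !det_mulmx mulrAC -det_mulmx PQX det1 mul1r.
Qed.

Lemma row_sqr (R : comNzRingType) n (u : 'rV[R]_n) :
  (u *m u^T) 0 0 = \sum_j u 0 j ^+ 2.
Proof. by rewrite mxE; apply: eq_bigr => j _; rewrite mxE expr2. Qed.

Lemma row_sqr_eq0 (R : realType) n (u : 'rV[R]_n) : (u *m u^T) 0 0 = 0 -> u = 0.
Proof.
rewrite row_sqr => /eqP; rewrite psumr_eq0 => [|j _]; last exact: sqr_ge0.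
move=> /allP h; apply/rowP => i; have := h i (mem_index_enum _).
by rewrite /= sqrf_eq0 mxE => /eqP.
Qed.

(** The reflection that exchanges v and the first basis vector. *)
Lemma reflection_to_row (R : realType) n (v : 'rV[R]_n.+1) : v *m v^T = 1%:M ->
  exists2 Q : 'M[R]_n.+1, Q *m Q^T = 1%:M & delta_mx 0 0 *m Q = v.
Proof.
set e : 'rV_n.+1 := delta_mx 0 0 => vv.
have ee : e *m e^T = 1%:M.
  by rewrite /e trmx_delta mul_delta_mx [RHS]mx11_scalar [LHS]mx11_scalar !mxE.
have [->|ev] := eqVneq v e; first by exists 1%:M; rewrite ?trmx1 ?mulmx1.
pose c := (e *m v^T) 0 0.
have evT : e *m v^T = c%:M by rewrite [LHS]mx11_scalar.
have veT : v *m e^T = c%:M by rewrite -[v]trmxK -trmx_mul evT tr_scalar_mx.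
pose w := e - v.
have ww : w *m w^T = (2 * (1 - c))%:M.
  rewrite /w linearB /= mulmxBl !mulmxBr ee vv evT veT -!raddfB /=; congr _%:M; ring.
have c1 : 1 - c != 0.
  apply: contraNneq ev => c0; rewrite c0 mulr0 in ww.
  have /eqP : w = 0 by apply: row_sqr_eq0; rewrite ww !mxE mul0rn.
  by rewrite subr_eq0 eq_sym.
pose S := w^T *m w; pose X := (1 - c)^-1 *: S; pose Q := 1%:M - X.
have XX : X *m X = X + X.
  rewrite -scalemxAl -scalemxAr scalerA /S mulmxA -[w^T *m w *m _]mulmxA ww.
  rewrite mul_mx_scalar -scalemxAl scalerA -scalerDl; congr (_ *: _).
  by field.
have QT : Q^T = Q by rewrite /Q linearB linearZ /= trmx1 trmx_mul trmxK.
exists Q.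
  rewrite QT /Q mulmxBl !mulmxBr !mul1mx mulmx1 XX.
  by rewrite opprB addrK addrNK.
rewrite /Q mulmxBr mulmx1 /X -scalemxAr mulmxA.
have -> : e *m w^T = (1 - c)%:M by rewrite /w linearB /= mulmxBr ee evT -raddfB.
by rewrite mul_scalar_mx scalerA mulVf // scale1r opprB addrC subrK.
Qed.

(** A root of the characteristic polynomial has a unit eigenvector. A reflection
    moves it to the first basis vector, and symmetry makes the reflected matrix
    block diagonal. The characteristic polynomial of the remaining block has the
    remaining roots, so the order of lam is preserved. *)
Theorem symmetric_diagonalizable (R : realType) n (A : 'M[R]_n) (lam : seq R) :
  A^T = A -> char_poly A = \prod_(x <- lam) ('X - x%:P) ->
  exists2 P : 'M[R]_n, P *m P^T = 1%:M &
    P *m A = diag_mx (\row_i lam`_i) *m P.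
Proof.
elim: n A lam => [|n IH] A lam AT chA.
  by exists 1%:M; rewrite ?flatmx0 // [LHS]flatmx0 [RHS]flatmx0.
case: lam chA => [|l lam] chA.
  by have := size_char_poly A; rewrite chA big_nil size_poly1.
have [u uA u0] : exists2 u : 'rV_n.+1, u *m A = l *: u & u != 0.
  apply/eigenvalueP; rewrite eigenvalue_root_char chA big_cons rootM.
  by rewrite root_XsubC eqxx.
pose nu := (u *m u^T) 0 0.
have nu0 : 0 < nu.
  rewrite lt_def; apply/andP; split.
    by apply: contraNneq u0 => /row_sqr_eq0 ->.
  by rewrite /nu row_sqr sumr_ge0 // => j _; exact: sqr_ge0.
pose v := (Num.sqrt nu)^-1 *: u.
have vv : v *m v^T = 1%:M.
  rewrite /v linearZ /= -scalemxAl -scalemxAr scalerA [u *m _]mx11_scalar -/nu.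
  by rewrite scale_scalar_mx -invfM -expr2 sqr_sqrtr ?ltW // mulVf ?gt_eqF.
have vA : v *m A = l *: v by rewrite /v -scalemxAl uA !scalerA mulrC.
have [Q QQ Qv] := reflection_to_row vv.
have QQ' : Q^T *m Q = 1%:M by apply: mulmx1C.
pose B : 'M_(1 + n) := Q *m A *m Q^T.
have BT : B^T = B by rewrite /B !trmx_mul trmxK AT mulmxA.
have chB : char_poly B = char_poly A by exact: char_poly_similar.
have BQ : B *m Q = Q *m A by rewrite /B -(mulmxA (Q *m A)) QQ' mulmx1.
have hB j : B 0 j = l * (j == 0)%:R.
  have : (delta_mx 0 0 : 'rV_n.+1) *m B = l *: delta_mx 0 0.
    by rewrite /B !mulmxA Qv vA -scalemxAl -Qv -mulmxA QQ mulmx1.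
  by rewrite -rowE => /rowP /(_ j); rewrite mxE => ->; rewrite !mxE eqxx.
clearbody B.
have l0 : lshift n (0 : 'I_1) = 0 by apply: val_inj.
have Bur : ursubmx B = 0.
  by apply/rowP => j; rewrite !mxE l0 hB mulr0.
have Bul : ulsubmx B = l%:M.
  by apply/matrixP => i j; rewrite !ord1 !mxE l0 hB eqxx mulr1.
have Bdl : dlsubmx B = 0 by rewrite -BT -trmx_ursub Bur trmx0.
pose B' := drsubmx B.
have EB : B = block_mx l%:M 0 0 B' by rewrite -[B]submxK Bur Bul Bdl.
have B'T : B'^T = B' by rewrite /B' trmx_drsub BT.
have chB' : char_poly B' = \prod_(x <- lam) ('X - x%:P).
  move: chB; rewrite chA EB big_cons.
  rewrite /char_poly char_block_diag_mx det_ublock.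
  rewrite {1}/char_poly_mx map_scalar_mx -raddfB /= det_scalar1.
  by apply: mulfI; rewrite polyXsubC_eq0.
have [P' PP PB] := IH B' lam B'T chB'.
pose P1 : 'M_(1 + n) := block_mx 1%:M 0 0 P'.
have P1P1 : P1 *m P1^T = 1%:M.
  rewrite /P1 tr_block_mx !trmx0 trmx1 mulmx_block !mulmx0 !mul0mx !addr0 add0r.
  by rewrite mulmx1 PP -scalar_mx_block.
have P1B : P1 *m B = diag_mx (\row_i (l :: lam)`_i) *m P1.
  have -> : diag_mx (\row_i (l :: lam)`_i)
      = block_mx l%:M 0 0 (diag_mx (\row_i lam`_i)) :> 'M_(1 + n).
    apply/matrixP => i j; rewrite !mxE.
    case: (splitP i) => i1 ei; rewrite !mxE; case: (splitP j) => j1 ej;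
      rewrite !mxE -!val_eqE /= ei ej.
    + by rewrite !ord1 /=.
    + by rewrite !ord1 /=.
    + by rewrite !ord1 /=.
    + by rewrite eqSS.
  rewrite EB /P1 !mulmx_block !mulmx0 !mul0mx !addr0 !add0r PB.
  by rewrite mul1mx mulmx1.
exists (P1 *m Q).
  by rewrite trmx_mul mulmxA -(mulmxA P1) QQ mulmx1.
by rewrite -mulmxA -BQ mulmxA P1B mulmxA.
Qed.

(** * Incidence numbers *)
Section TupleSigns.
Variable V : finType.

Lemma mem_face m (u : m.+2.-tuple V) i v : uniq u ->
  (v \in face u i) = (v \in u) && (v != tnth u i).
Proof.
move=> /tuple_uniqP uu; apply/tnthP/andP => [[j ->]|[/tnthP[j ->] ne]].
  rewrite tnth_mktuple mem_tnth; split=> //.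
  by rewrite (inj_eq uu) eq_sym neq_lift.
have ij : i != j by apply: contraNneq ne => ->.
by have [j' ->] := unlift_some ij; exists j'; rewrite tnth_mktuple.
Qed.

Lemma face_uniq m (u : m.+2.-tuple V) i : uniq u -> uniq (face u i).
Proof.
move=> /tuple_uniqP uu; apply/tuple_uniqP => j j'; rewrite !tnth_mktuple.
by move/uu/lift_inj.
Qed.

Section Coefficients.
Variable A : pzRingType.

Lemma rel_sign_eq0 m (u w : m.-tuple V) : ~ (u =i w) -> rel_sign A u w = 0.
Proof.
move=> uw; rewrite /rel_sign big_pred0 // => p; apply/negbTE/eqP => eu.
case: uw; rewrite eu => v; apply/tnthP/tnthP => [[j ->]|[j ->]].
  by exists (p j); rewrite tnth_mktuple.
by exists (p^-1%g j); rewrite tnth_mktuple permKV.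
Qed.

(** Without repeated vertices, exactly one permutation carries w to u. *)
Lemma rel_sign_pm1 m (u w : m.-tuple V) : uniq u -> uniq w -> u =i w ->
  rel_sign A u w = 1 \/ rel_sign A u w = -1.
Proof.
move=> uu uw euw; have /tuple_permP [p ep] := uniq_perm uu uw euw.
have {}ep : u = [tuple tnth w (p j) | j < m] by apply: val_inj.
rewrite /rel_sign (big_pred1 p) => [|q /=].
  by case: (odd_perm p); [right|left]; rewrite ?expr1 ?expr0.
apply/eqP/eqP => [|->//]; rewrite {1}ep => epq; apply/permP => j.
have := congr1 (fun t => tnth t j) epq; rewrite !tnth_mktuple.
by move/tuple_uniqP: uw => uw /uw.
Qed.

(** Exactly one face of u has the vertices of w, namely the one that omits the
    only vertex of u outside w. *)
Lemma bd_coef_pm1 m (w : m.+1.-tuple V) (u : m.+2.-tuple V) :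
  uniq w -> uniq u -> {subset w <= u} ->
  bd_coef A w u = 1 \/ bd_coef A w u = -1.
Proof.
move=> uw uu wu.
have [v vu vw] : exists2 v, v \in u & v \notin w.
  have : ~~ ([set x in u] \subset [set x in w]).
    apply/negP => /subset_leq_card; rewrite !cardsE (card_uniqP uu) (card_uniqP uw).
    by rewrite !size_tuple ltnn.
  by case/subsetPn => v; rewrite !inE => vu vw; exists v.
have /tnthP[i ei] := vu.
have facei j : face u j =i w <-> j = i.
  split=> [e|->].
    have := e v; rewrite (negbTE vw) mem_face // vu /= => /negbFE /eqP.
    by rewrite ei => /(tuple_uniqP _ uu).
  move=> x; apply/idP/idP => [|xw]; last first.
    by rewrite mem_face // wu //= -ei; apply: contraTneq xw => ->.
  have /uniq_min_size H := uw.
  have sub : {subset w <= face u i}.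
    by move=> y yw; rewrite mem_face // wu //= -ei; apply: contraTneq yw => ->.
  by have [|_ ->] := H _ sub; rewrite ?size_tuple.
rewrite /bd_coef (bigD1 i) //= big1 ?addr0 => [|j ji]; last first.
  by rewrite rel_sign_eq0 ?mulr0 // => /facei /eqP; rewrite (negbTE ji).
have [->|->] := rel_sign_pm1 (face_uniq i uu) uw ((facei i).2 erefl).
  by rewrite mulr1 -signr_odd; case: odd; [right|left].
by rewrite mulrN1 -signr_odd; case: odd; [left|right]; rewrite ?opprK.
Qed.
End Coefficients.

Lemma bd_coef_int (A : pzRingType) m (w : m.+1.-tuple V) (u : m.+2.-tuple V) :
  (bd_coef int w u)%:~R = bd_coef A w u.
Proof.
rewrite /bd_coef rmorph_sum; apply: eq_bigr => i _.
rewrite rmorphM rmorphXn rmorphN1; congr (_ * _).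
by rewrite /rel_sign rmorph_sum; apply: eq_bigr => p _; rewrite rmorphXn rmorphN1.
Qed.
End TupleSigns.

(** * The signed graph of common cofaces *)
Section Cofaces.
Variables (V : finType) (K : {set {set V}}).
Variables (o : forall m, {set V} -> m.+1.-tuple V) (d : nat).
Hypothesis complexK : simplicial_complex K.
Hypothesis orientK : orientation K o.
Local Notation S := (simplices K d).
Local Notation S' := (simplices K d.+1).
Implicit Types t s : {set V}.

Lemma simplicesP m s : reflect (s \in K /\ #|s| = m.+1) (s \in simplices K m).
Proof. by rewrite inE; apply: (iffP andP) => -[sK /eqP]. Qed.

Lemma orientation_uniq m s : s \in simplices K m -> uniq (o m s).
Proof.
move=> sS; apply/card_uniqP; rewrite size_tuple -cardsE (orientK sS).
by case/simplicesP: sS.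
Qed.

Lemma mem_orientation m s : s \in simplices K m -> o m s =i s.
Proof. by move=> sS v; rewrite -{2}(orientK sS) inE. Qed.

Lemma sgn_pm1 (A : pzRingType) t s : t \in S -> s \in S' -> t \subset s ->
  sgn o d A t s = 1 \/ sgn o d A t s = -1.
Proof.
move=> tS sS ts; apply: bd_coef_pm1; rewrite ?orientation_uniq // => v.
by rewrite !mem_orientation //; apply: (fintype.subsetP ts).
Qed.

Lemma sgn_int (A : pzRingType) t s : (sgn o d int t s)%:~R = sgn o d A t s.
Proof. exact: bd_coef_int. Qed.

(** The union of two distinct d-simplices has at least d + 2 vertices. *)
Lemma common_coface t t' s : t \in S -> t' \in S -> s \in S' ->
  t != t' -> t \subset s -> t' \subset s -> s = t :|: t'.
Proof.
move=> /simplicesP[_ ct] /simplicesP[_ ct'] /simplicesP[_ cs] neq ts ts'.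
apply/eqP; rewrite eq_sym eqEcard finset.subUset ts ts' /= cs -ct.
rewrite proper_card // finset.properEneq finset.subsetUl andbT.
apply: contraNneq neq => e; rewrite eq_sym eqEcard ct ct' leqnn andbT.
by rewrite e finset.subsetUr.
Qed.

Lemma card_faces s : s \in S' -> #|[set t in S | t \subset s]| = d.+2.
Proof.
move=> /simplicesP[sK cs].
have -> : [set t in S | t \subset s] = [set t : {set V} | t \subset s & #|t| == d.+1].
  apply/finset.setP => t; rewrite !inE; case ts: (t \subset s); rewrite ?andbF ?andbT //=.
  have [ct|] := boolP (#|t| == _); rewrite ?andbF ?andbT //.
  by apply: (complexK sK) => //; rewrite -card_gt0 (eqP ct).
by rewrite cards_draws cs binSn.
Qed.

Lemma adj_sym : symmetric (adj K d).
Proof.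
move=> t t'; rewrite /adj eq_sym; congr (_ && _); apply: eq_existsb => s.
by rewrite [(t \subset s) && _]andbC.
Qed.

Lemma adj_sign_sym e : symmetric (adj_sign K o d e).
Proof.
move=> t t'; rewrite /adj_sign eq_sym; congr (_ && _); apply: eq_existsb => s.
by congr (_ && _); rewrite andbCA [sgn _ _ _ t s * _]mulrC.
Qed.

Lemma adj_signP e t t' : t \in S -> t' \in S -> t != t' ->
  adj_sign K o d e t t' = adj K d t t' &&
    (sgn o d int t (t :|: t') * sgn o d int t' (t :|: t') == e).
Proof.
move=> tS tS' neq; rewrite /adj_sign /adj neq /=.
apply/existsP/andP => [[s /and4P[sS ts ts' es]]|[/existsP[s /and3P[sS ts ts']] es]].
  rewrite -(common_coface tS tS' sS neq ts ts'); split=> //.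
  by apply/existsP; exists s; rewrite sS ts.
by exists s; rewrite sS ts ts' (common_coface tS tS' sS neq ts ts') es.
Qed.

Lemma sum_common_cofaces (R : realType) (Phi : {set V} -> R) t t' :
  t \in S -> t' \in S -> t != t' ->
  \sum_(s in S' | (t \subset s) && (t' \subset s)) Phi s
    = (adj K d t t')%:R * Phi (t :|: t').
Proof.
move=> tS tS' neq.
have [/andP[_ /existsP[s /and3P[sS ts ts']]]|none] := boolP (adj K d t t').
  rewrite mul1r (big_pred1 s) => [|s' /=].
    by rewrite (common_coface tS tS' sS neq ts ts').
  apply/and3P/eqP => [[sS' hs hs']|->//].
  by rewrite (common_coface tS tS' sS' neq hs hs') (common_coface tS tS' sS neq ts ts').
rewrite mul0r big_pred0 // => s; apply/negbTE/and3P => -[sS ts ts'].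
by case/negP: none; rewrite /adj neq; apply/existsP; exists s; rewrite sS ts.
Qed.

Section Graph.
Variable R : realType.
Hypothesis cofaceK : every_simplex_in_coface K d.
Local Notation T := ('I_#|S|).
Local Notation simplex := (@simplex V K d).

Definition coface_weight (i j : T) : R := (adj K d (simplex i) (simplex j))%:R.
Definition coface_esign (i j : T) : R :=
  if adj_sign K o d (-1) (simplex i) (simplex j) then -1 else 1.
Definition coface_deg (i : T) : R := (deg K d (simplex i))%:R.

Lemma coface_weight_ge0 i j : 0 <= coface_weight i j. Proof. exact: ler0n. Qed.
Lemma coface_weight_sym i j : coface_weight i j = coface_weight j i.
Proof. by rewrite /coface_weight adj_sym. Qed.
Lemma coface_esign_sym i j : coface_esign i j = coface_esign j i.
Proof. by rewrite /coface_esign adj_sign_sym. Qed.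
Lemma coface_esign_pm1 i j : coface_esign i j = 1 \/ coface_esign i j = -1.
Proof. by rewrite /coface_esign; case: ifP; [right|left]. Qed.
Lemma coface_deg_gt0 i : 0 < coface_deg i.
Proof.
have [s sS ts] := cofaceK (enum_valP i).
by rewrite ltr0n card_gt0; apply/set0Pn; exists s; rewrite inE sS.
Qed.

Definition coface_graph : signed_graph R T :=
  SignedGraph coface_weight_ge0 coface_weight_sym coface_esign_sym
    coface_esign_pm1 coface_deg_gt0.

Lemma simplexS i : simplex i \in S. Proof. exact: enum_valP. Qed.

Lemma simplex_inj : injective simplex. Proof. exact: enum_val_inj. Qed.

Lemma sum_simplex (Phi : {set V} -> R) : \sum_i Phi (simplex i) = \sum_(t in S) Phi t.
Proof. by rewrite [RHS]big_enum_val. Qed.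

Lemma coface_esign_eq i j : coface_weight i j != 0 ->
  coface_esign i j = sgn o d R (simplex i) (simplex i :|: simplex j) *
               sgn o d R (simplex j) (simplex i :|: simplex j).
Proof.
rewrite pnatr_eq0 eqb0 negbK => adjij.
have /andP[neq /existsP[s /and3P[sS ts ts']]] := adjij.
rewrite /coface_esign adj_signP ?simplexS // adjij /=.
rewrite -!(sgn_int R) -(common_coface (simplexS i) (simplexS j) sS neq ts ts').
by have [->|->] := sgn_pm1 int (simplexS i) sS ts;
  have [->|->] := sgn_pm1 int (simplexS j) sS ts';
  rewrite ?rmorphN ?rmorph1 ?mulrNN ?mulr1 ?mul1r ?mulN1r.
Qed.

(** The bilinear form of the up Laplacian for the scalar product weighted by the
    degrees. *)
Definition up_coef (i j : T) : R :=
  \sum_(s in S' | (simplex i \subset s) && (simplex j \subset s))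
     sgn o d R (simplex i) s * sgn o d R (simplex j) s.

Lemma up_coef_diag i : up_coef i i = coface_deg i.
Proof.
rewrite /up_coef /coface_deg /deg -sumr_const big_mkcond [RHS]big_mkcond.
apply: eq_bigr => s _; rewrite inE andbb; case: ifP => // /andP[sS ts].
by have [->|->] := sgn_pm1 R (simplexS i) sS ts; rewrite ?mulrNN mulr1.
Qed.

Lemma up_coef_offdiag i j : i != j -> up_coef i j = coface_weight i j * coface_esign i j.
Proof.
move=> ij; rewrite /up_coef sum_common_cofaces ?simplexS ?(inj_eq simplex_inj) //.
rewrite -/(coface_weight i j); have [->|nz] := eqVneq (coface_weight i j) 0; first by rewrite !mul0r.
by rewrite coface_esign_eq.
Qed.

Lemma coface_weight_diag i : coface_weight i i = 0.
Proof. by rewrite /coface_weight /adj eqxx. Qed.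

(** Every coface of a d-simplex has d + 1 other faces, and different cofaces have
    no other face in common. *)
Lemma sum_coface_weight i : \sum_j coface_weight i j = d.+1%:R * coface_deg i.
Proof.
have -> : \sum_j coface_weight i j = \sum_(t in S | t != simplex i)
    \sum_(s in S' | (simplex i \subset s) && (t \subset s)) 1.
  rewrite big_mkcondr -sum_simplex; apply: eq_bigr => j _.
  rewrite (inj_eq simplex_inj) eq_sym.
  case: ifP => [ij|/negbFE/eqP<-]; last exact: coface_weight_diag.
  by rewrite sum_common_cofaces ?simplexS ?(inj_eq simplex_inj) // mulr1.
rewrite (exchange_big_dep (fun s => (s \in S') && (simplex i \subset s))) /=; last first.
  by move=> t s _ /and3P[-> ->].
rewrite (eq_bigr (fun=> d.+1%:R)) => [|s /andP[sS ts]].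
  rewrite sumr_const mulr_natr; congr (_ *+ _); apply: eq_card => s.
  by rewrite finset.in_set unfold_in.
rewrite sumr_const; congr _%:R; apply/eq_add_S.
have iF : simplex i \in [set t in S | t \subset s] by rewrite finset.in_set simplexS.
rewrite -[RHS](card_faces sS) [RHS](cardsD1 (simplex i)) iF add1n.
congr _.+1; apply: eq_card => t.
rewrite finset.in_setD1 [X in _ && X]finset.in_set [LHS]unfold_in sS ts /=.
by rewrite [(t \in S) && _]andbC andbA.
Qed.

(** After expansion of the squares, the diagonal terms of the energy are
    (d + 1) deg, by the count of neighbours, and those of the bilinear form are
    deg; the off-diagonal terms are opposite. *)
Lemma coface_energy f :
  energy coface_graph f = d.+2%:R * inner coface_graph f f
    - \sum_i \sum_j up_coef i j * (f i * f j).
Proof.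
have W : \sum_i \sum_j coface_weight i j * f i ^+ 2
    = d.+1%:R * \sum_i coface_deg i * f i ^+ 2.
  rewrite mulr_sumr; apply: eq_bigr => i _.
  by rewrite -mulr_suml sum_coface_weight mulrA.
have W' : \sum_i \sum_j coface_weight i j * f j ^+ 2
    = d.+1%:R * \sum_i coface_deg i * f i ^+ 2.
  rewrite -W exchange_big; apply: eq_bigr => i _; apply: eq_bigr => j _.
  by rewrite coface_weight_sym.
have U : \sum_i \sum_j up_coef i j * (f i * f j)
    = \sum_i coface_deg i * f i ^+ 2
      + \sum_i \sum_j coface_weight i j * coface_esign i j * (f i * f j).
  rewrite -big_split; apply: eq_bigr => i _ /=.
  rewrite (bigD1 i) //= up_coef_diag expr2; congr (_ + _).
  rewrite [RHS](bigD1 i) //= coface_weight_diag !mul0r add0r; apply: eq_bigr => j ji.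
  by rewrite up_coef_offdiag // eq_sym.
have -> : energy coface_graph f = 2^-1 * (\sum_i \sum_j coface_weight i j * f i ^+ 2
    + \sum_i \sum_j coface_weight i j * f j ^+ 2
    - 2 * \sum_i \sum_j coface_weight i j * coface_esign i j * (f i * f j)).
  rewrite /energy; congr (_ * _); rewrite mulr_sumr -sumrN -!big_split.
  apply: eq_bigr => i _ /=; rewrite mulr_sumr -sumrN -!big_split.
  apply: eq_bigr => j _ /=; rewrite -/(coface_weight i j).
  have : coface_esign i j ^+ 2 = 1 by rewrite -(esign_sqr coface_graph i j).
  move=> s2; transitivity (coface_weight i j * f i ^+ 2
     + coface_weight i j * (coface_esign i j ^+ 2 * f j ^+ 2)
     - 2 * (coface_weight i j * coface_esign i j * (f i * f j))); first by rewrite /=; ring.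
  by rewrite s2 mul1r.
have -> : inner coface_graph f f = \sum_i coface_deg i * f i ^+ 2.
  by apply: eq_bigr => i _; rewrite expr2.
by rewrite W W' U -[d.+2%:R]natr1; lra.
Qed.
End Graph.
End Cofaces.

(** * Edge counts and variation *)
Section EdgeCounts.
Variables (V : finType).
Implicit Types (r : rel {set V}) (A B : {set {set V}}).

Let pairs r A B := [set p : {set V} * {set V} | [&& p.1 \in A, p.2 \in B & r p.1 p.2]].

Lemma edges_imset r A B : edges r A B = (fun p => [set p.1; p.2]) @: pairs r A B.
Proof.
apply/finset.setP => e; apply/imset2P/imsetP.
  move=> [t t' tA]; rewrite inE => /andP[tB rt] ->.
  by exists (t, t'); rewrite // inE tA tB.
move=> [[t t']]; rewrite inE => /and3P[tA tB rt] ->.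
by exists t t' => //; rewrite inE tB.
Qed.

Lemma card_pairs r A B : #|pairs r A B| = (\sum_(t in A) \sum_(t' in B) r t t')%N.
Proof.
rewrite -sum1_card (eq_bigl (fun p => (p.1 \in A) && ((p.2 \in B) && r p.1 p.2))); last first.
  by move=> p; rewrite inE.
rewrite -(pair_big_dep (mem A) (fun t t' => (t' \in B) && r t t') (fun _ _ => 1%N)).
by apply: eq_bigr => t _; rewrite big_mkcondr.
Qed.

Lemma set2_inj (t t' u u' : {set V}) : [set t; t'] = [set u; u'] ->
  (t, t') = (u, u') \/ (t, t') = (u', u).
Proof.
move=> e.
have h1 : t \in [set u; u'] by rewrite -e set21.
have h2 : t' \in [set u; u'] by rewrite -e set22.
have h3 : u \in [set t; t'] by rewrite e set21.
have h4 : u' \in [set t; t'] by rewrite e set22.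
move: h1 h2 h3 h4; rewrite !inE.
by do 4!(case/orP => /eqP ?); subst; auto.
Qed.

Lemma card_edges_disjoint r A B : [disjoint A & B] ->
  #|edges r A B| = (\sum_(t in A) \sum_(t' in B) r t t')%N.
Proof.
move=> dAB; rewrite -card_pairs edges_imset card_in_imset // => -[t t'] [u u'].
rewrite !inE /= => /and3P[tA tB _] /and3P[uA uB _] /set2_inj [//|[eu _]].
by rewrite eu (disjointFl dAB uB) in tA.
Qed.

(** Each edge inside A comes from exactly two ordered pairs. *)
Lemma card_edges_self r A : symmetric r -> irreflexive r ->
  (2 * #|edges r A A| = \sum_(t in A) \sum_(t' in A) r t t')%N.
Proof.
move=> rsym rirr; rewrite -card_pairs edges_imset.
rewrite -[RHS]sum1_card [RHS]
  (partition_big_imset (fun p : {set V} * {set V} => [set p.1; p.2])) /=.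
rewrite mulnC -sum_nat_const; apply: eq_bigr => e /imsetP[[t t']].
rewrite inE /= => /and3P[tA tB rt] ->.
have neq : t != t' by apply: contraTneq rt => ->; rewrite rirr.
rewrite sum1_card.
transitivity #|[set (t, t'); (t', t)]|.
  rewrite cards2; congr (_.+1); apply/esym/eqP; rewrite eqb1.
  by apply: contraNneq neq => -[-> _].
apply: eq_card => -[u u']; rewrite !inE /= unfold_in /= !inE /=.
apply/orP/andP => [[] /eqP[-> ->]|].
- by rewrite tA tB rt eqxx.
- by rewrite tA tB rsym rt finset.setUC eqxx.
by move=> [_ /eqP /set2_inj [->|->]]; [left|right].
Qed.
End EdgeCounts.

Section BetaQuotient.
Variables (V : finType) (K : {set {set V}}).
Variables (o : forall m, {set V} -> m.+1.-tuple V) (d : nat) (R : realType).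
Hypothesis orientK : orientation K o.
Hypothesis cofaceK : every_simplex_in_coface K d.
Local Notation S := (simplices K d).
Local Notation simplex := (@simplex V K d).
Local Notation G := (coface_graph o R cofaceK).
Implicit Types (A B : {set {set V}}).

Definition split_fun A B (i : 'I_#|S|) : R :=
  (simplex i \in A)%:R - (simplex i \in B)%:R.

Lemma sum_simplex_subset A (Phi : {set V} -> R) : A \subset S ->
  \sum_i (simplex i \in A)%:R * Phi (simplex i) = \sum_(t in A) Phi t.
Proof.
move=> AS; rewrite (sum_simplex K d (fun t => (t \in A)%:R * Phi t)).
rewrite [RHS](eq_bigl (fun t => (t \in S) && (t \in A))); last first.
  by move=> t /=; case tA: (t \in A); rewrite ?andbF // (fintype.subsetP AS).
rewrite [RHS]big_mkcondr; apply: eq_bigr => t _.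
by case: (t \in A); rewrite ?mul1r ?mul0r.
Qed.

Lemma sum_pairs A B (r : rel {set V}) : A \subset S -> B \subset S ->
  (\sum_(t in A) \sum_(t' in B) r t t')%:R =
  \sum_i \sum_j (simplex i \in A)%:R * (simplex j \in B)%:R
                * (r (simplex i) (simplex j))%:R :> R.
Proof.
move=> AS BS; rewrite natr_sum -sum_simplex_subset //; apply: eq_bigr => i _.
rewrite natr_sum -(sum_simplex_subset (fun t' => (r (simplex i) t')%:R)) //.
by rewrite mulr_sumr; apply: eq_bigr => j _; rewrite mulrA.
Qed.

Lemma adj_sign1E (i j : 'I_#|S|) : adj_sign K o d 1 (simplex i) (simplex j) =
  adj K d (simplex i) (simplex j) && ~~ adj_sign K o d (-1) (simplex i) (simplex j).
Proof.
have [->|ij] := eqVneq i j; first by rewrite /adj_sign /adj eqxx.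
have neq : simplex i != simplex j by rewrite (inj_eq (@simplex_inj _ _ _)).
rewrite !adj_signP ?simplexS //.
have [/andP[_ /existsP[s /and3P[sS ts ts']]]|//] := boolP (adj _ _ _ _).
rewrite -(common_coface (simplexS i) (simplexS j) sS neq ts ts') /=.
by have [->|->] := sgn_pm1 orientK int (simplexS i) sS ts;
  have [->|->] := sgn_pm1 orientK int (simplexS j) sS ts'.
Qed.

(** For f = 1_A - 1_B the difference f(t) - sgn f(t') is 2 in absolute value at
    the edges that contradict the splitting, 1 at the boundary edges and 0 at the
    other ones. *)
Lemma beta_variation A B : A \subset S -> B \subset S -> [disjoint A & B] ->
  beta K o d R A B = variation G (split_fun A B) / mass G (split_fun A B).
Proof.
move=> AS BS dAB.
have US : A :|: B \subset S by rewrite finset.subUset AS.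
have inU t : (t \in A :|: B) = (t \in A) || (t \in B) by rewrite finset.in_setU.
have dis t : (t \in A) && (t \in B) = false.
  by apply/negbTE/andP => -[tA tB]; rewrite (disjointFr dAB tA) in tB.
rewrite /beta; congr (_ / _); last first.
  rewrite /vol natr_sum -sum_simplex_subset //; apply: eq_bigr => i _.
  rewrite mulrC /=; congr (_ * _); rewrite inU /split_fun.
  have := dis (simplex i); case: (_ \in A); case: (_ \in B) => //= _.
  - by rewrite subr0 normr1.
  - by rewrite sub0r normrN1.
  - by rewrite subr0 normr0.
pose n (i j : 'I_#|S|) := adj_sign K o d (-1) (simplex i) (simplex j).
pose w (i j : 'I_#|S|) := adj K d (simplex i) (simplex j).
pose a (i : 'I_#|S|) := simplex i \in A.
pose b (i : 'I_#|S|) := simplex i \in B.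
(* H counts ordered pairs in an asymmetric way; only the sum of H i j and H j i
   agrees with the corresponding term of the variation *)
pose H i j : R := (a i)%:R * (a j)%:R * (n i j)%:R + (b i)%:R * (b j)%:R * (n i j)%:R
   + 2 * ((a i)%:R * (b j)%:R * (w i j && ~~ n i j)%:R)
   + (a i || b i)%:R * (~~ (a j || b j))%:R * (w i j)%:R.
have numE : (2 * (#|edges (adj_sign K o d (-1)) A A| + #|edges (adj_sign K o d (-1)) B B|
        + #|edges (adj_sign K o d 1) A B|)
   + #|edges (adj K d) (A :|: B) (S :\: (A :|: B))|)%N%:R = \sum_i \sum_j H i j.
  have irr : irreflexive (adj_sign K o d (-1)) by move=> t; rewrite /adj_sign eqxx.
  have sym := @adj_sign_sym V K o d (-1).
  have dU : [disjoint A :|: B & S :\: (A :|: B)].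
    by rewrite -setI_eq0 finset.setIDA finset.setIC finset.setDIl finset.setDv finset.setI0.
  rewrite !mulnDr !card_edges_self // !card_edges_disjoint // !natrD addr0.
  rewrite -mulr2n -[_ *+ 2]mulr_natl.
  rewrite !sum_pairs ?finset.subsetDl // mulr_sumr -!big_split; apply: eq_bigr => i _ /=.
  rewrite mulr_sumr -!big_split; apply: eq_bigr => j _ /=.
  rewrite /H !inU finset.in_setD inU simplexS andbT adj_sign1E.
  by [].
rewrite numE /variation.
have -> : \sum_i \sum_j H i j = 2^-1 * \sum_i \sum_j (H i j + H j i).
  under [in RHS]eq_bigr do rewrite big_split.
  rewrite big_split /= [X in _ + X]exchange_big /=; lra.
congr (_ * _); apply: eq_bigr => i _; apply: eq_bigr => j _ /=.
rewrite /coface_weight /coface_esign -/(n i j) -/(w i j) /H.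
have -> : n j i = n i j by rewrite /n adj_sign_sym.
have -> : w j i = w i j by rewrite /w adj_sym.
have nw : n i j -> w i j.
  by case/andP=> ne /existsP[s /and4P[sS ts ts' _]]; rewrite /w /adj ne;
    apply/existsP; exists s; rewrite sS ts.
have di := dis (simplex i); have dj := dis (simplex j).
rewrite /split_fun -/(a i) -/(a j) -/(b i) -/(b j) in di dj *.
have norm2 : `|1 + 1| = 1 + 1 :> R by rewrite ger0_norm // addr_ge0.
move: nw di dj; case: (n i j); case: (w i j) => /= nw.
- case: (a i); case: (b i) => //= _; case: (a j); case: (b j) => //= _;
    rewrite ?(mulr0, mulr1, mul1r, addr0, add0r, subr0, sub0r, mulN1r, opprK)
      -?opprD ?(oppr0, add0r, addr0, opprK, subrr, addNr, normrN, normr0, normr1, norm2);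
    lra.
- by have := nw isT.
- case: (a i); case: (b i) => //= _; case: (a j); case: (b j) => //= _;
    rewrite ?(mulr0, mulr1, mul1r, addr0, add0r, subr0, sub0r, opprK)
      -?opprD ?(oppr0, add0r, addr0, opprK, subrr, addNr, normrN, normr0, normr1, norm2);
    lra.
- by rewrite !mul0r !mulr0 !addr0.
Qed.
End BetaQuotient.

(** * Eigenvalues and Cheeger constants *)
Section Eigenbasis.
Variables (V : finType) (K : {set {set V}}).
Variables (o : forall m, {set V} -> m.+1.-tuple V) (d : nat) (R : realType).
Hypothesis complexK : simplicial_complex K.
Hypothesis orientK : orientation K o.
Hypothesis cofaceK : every_simplex_in_coface K d.
Local Notation S := (simplices K d).
Local Notation G := (coface_graph o R cofaceK).
Local Notation upc := (@up_coef V K o d R).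

Lemma up_coef_sym i j : upc i j = upc j i.
Proof.
apply: eq_big => [s|s _]; last exact: mulrC.
by rewrite [(simplex i \subset s) && _]andbC.
Qed.

(** The up Laplacian L is similar to the symmetric matrix D L D^-1, where D is
    the diagonal matrix of the square roots of the degrees. Dividing an
    orthonormal eigenbasis of the latter by these square roots gives one of L for
    the weighted scalar product. *)
Theorem eigenbasis (lam : seq R) : up_spectrum K o d lam ->
  exists F : 'I_#|S| -> 'I_#|S| -> R,
    [/\ forall i j, inner G (F i) (F j) = (i == j)%:R,
        forall f, inner G f f = \sum_i inner G f (F i) ^+ 2
      & forall f, energy G f = \sum_(i < #|S|) (d.+2%:R - lam`_i) * inner G f (F i) ^+ 2].
Proof.
move=> [_ chL]; set L := up_laplacian K o d R in chL.
pose g i := vmass G i; have g0 i : 0 < g i by exact: (vmass_gt0 G i).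
pose sd i := Num.sqrt (g i).
have sd0 i : sd i != 0 by rewrite gt_eqF // sqrtr_gt0.
have sdg i : sd i ^+ 2 = g i by rewrite sqr_sqrtr // ltW.
pose D1 := diag_mx (\row_i sd i); pose D2 := diag_mx (\row_i (sd i)^-1).
have D12 : D1 *m D2 = 1%:M.
  rewrite mulmx_diag; apply/matrixP => i j; rewrite !mxE.
  by case: eqVneq => [->|]; rewrite ?mulr0n // mulfV.
pose A := D1 *m L *m D2.
have AE i j : A i j = upc i j / (sd i * sd j).
  rewrite /A mul_mx_diag mul_diag_mx !mxE -/(upc i j).
  rewrite -[X in X^-1]/(g i) -sdg; have := sd0 i; have := sd0 j.
  move: (sd i) (sd j) => x y y0 x0.
  by field; rewrite x0 y0.
have AT : A^T = A by apply/matrixP => i j; rewrite mxE !AE up_coef_sym [sd j * _]mulrC.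
have chA : char_poly A = \prod_(x <- lam) ('X - x%:P).
  by rewrite -chL; exact: char_poly_similar.
clearbody A.
have [P PP PA] := symmetric_diagonalizable AT chA.
have PP' : P^T *m P = 1%:M by apply: mulmx1C.
pose F i t := P i t / sd t.
pose y (f : 'I_#|S| -> R) : 'rV_#|S| := \row_t (f t * sd t).
pose c f := y f *m P^T.
have cE f i : c f 0 i = inner G f (F i).
  rewrite mxE; apply: eq_bigr => t _; rewrite !mxE -[vmass G t]/(g t) -sdg /F.
  by have := sd0 t; move: (sd t) => x x0; field.
have yc f : c f *m P = y f by rewrite /c -mulmxA PP' mulmx1.
have parseval f : inner G f f = \sum_i inner G f (F i) ^+ 2.
  have -> : inner G f f = (y f *m (y f)^T) 0 0.
    rewrite row_sqr; apply: eq_bigr => t _; rewrite mxE -[vmass G t]/(g t) -sdg; ring.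
  rewrite -[in LHS]yc trmx_mul mulmxA -(mulmxA _ P) PP mulmx1 row_sqr.
  by apply: eq_bigr => i _; rewrite cE.
exists F; split=> [i j|//|f].
- have := congr1 (fun M : 'M_#|S| => M i j) PP; rewrite /= !mxE => <-.
  apply: eq_bigr => t _; rewrite !mxE -[vmass G t]/(g t) -sdg /F.
  by have := sd0 t; move: (sd t) => x x0; field.
have form : \sum_i \sum_j upc i j * (f i * f j)
    = \sum_(i < #|S|) lam`_i * inner G f (F i) ^+ 2.
  transitivity ((y f *m A *m (y f)^T) 0 0).
    rewrite mxE [LHS]exchange_big; apply: eq_bigr => j _; rewrite !mxE mulr_suml.
    apply: eq_bigr => i _; rewrite !mxE AE; have := sd0 i; have := sd0 j.
    by move: (sd i) (sd j) => x z z0 x0; field; rewrite x0 z0.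
  rewrite -yc trmx_mul -!mulmxA (mulmxA P A) PA -!mulmxA (mulmxA P) PP mul1mx.
  rewrite mulmxA -/(c f) mul_diag_mx mxE; apply: eq_bigr => i _.
  by rewrite -cE; move: (c f) => u; rewrite !mxE; ring.
rewrite coface_energy // form -/G parseval.
rewrite mulr_sumr -sumrB; apply: eq_bigr => i _; ring.
Qed.
End Eigenbasis.

Section CheegerInequality.
Variables (V : finType) (K : {set {set V}}).
Variables (o : forall m, {set V} -> m.+1.-tuple V) (d : nat) (R : realType).
Hypothesis complexK : simplicial_complex K.
Hypothesis orientK : orientation K o.
Hypothesis cofaceK : every_simplex_in_coface K d.
Local Notation S := (simplices K d).
Local Notation n := #|S|.
Local Notation simplex := (@simplex V K d).
Local Notation G := (coface_graph o R cofaceK).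
Local Notation family k := {ffun 'I_k * bool -> {set {set V}}}.

Lemma beta_ge0 A B : 0 <= beta K o d R A B.
Proof. by rewrite divr_ge0. Qed.

Lemma max_beta_ge0 k (A : family k) : 0 <= max_beta K o d R A.
Proof.
by apply: (big_ind (fun x => 0 <= x)) => // [x y x0 y0|i _]; rewrite ?le_max ?x0 ?beta_ge0.
Qed.

Lemma cheeger_ge0 k (A0 : family k) : admissible K d A0 -> 0 <= cheeger K o d R k.
Proof.
move=> A0ok; apply: lb_le_inf; first by exists (max_beta K o d R A0); exists A0.
by move=> x [A _ ->]; exact: max_beta_ge0.
Qed.

Lemma cheeger_le k (A : family k) :
  admissible K d A -> cheeger K o d R k <= max_beta K o d R A.
Proof.
move=> Aok; apply: ge_inf; last by exists A.
by exists 0 => x [B _ ->]; exact: max_beta_ge0.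
Qed.

Lemma exists_admissible k : (k <= n)%N -> exists A : family k, admissible K d A.
Proof.
move=> kn; pose t (i : 'I_k) := simplex (widen_ord kn i).
exists [ffun x => if x.2 then finset.set0 else [set t x.1]].
apply/and3P; split.
- apply/forallP => -[i []]; rewrite ffunE /= ?finset.sub0set //.
  by rewrite finset.sub1set simplexS.
- apply/forallP => -[i b]; apply/forallP => -[j c]; apply/implyP => neq.
  rewrite !ffunE /=; case: b neq; first by rewrite -setI_eq0 finset.set0I.
  case: c; first by rewrite -setI_eq0 finset.setI0.
  move=> neq; rewrite disjoints1 inE (inj_eq (@simplex_inj _ _ _)).
  by apply: contraNneq neq => /(congr1 val) /= e; apply/eqP; congr (_, _); apply: val_inj.
- apply/forallP => i; rewrite !ffunE /= finset.setU0.
  by apply/set0Pn; exists (t i); rewrite finset.set11.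
Qed.

Section Cuts.
Variables (k : nat) (chi : 'I_k -> 'I_n -> R).
Hypothesis chi_pm : forall i x, [\/ chi i x = 0, chi i x = 1 | chi i x = -1].
Hypothesis chi_neq0 : forall i, exists x, chi i x != 0.
Hypothesis chi_dis : forall i j x, i != j -> chi i x != 0 -> chi j x = 0.

Definition cut_family : family k :=
  [ffun p : 'I_k * bool => simplex @: [set x | chi p.1 x == (-1) ^+ p.2]].

Lemma mem_cut_family (p : 'I_k * bool) x :
  (simplex x \in cut_family p) = (chi p.1 x == (-1) ^+ p.2).
Proof. by rewrite ffunE mem_imset ?inE //; exact: simplex_inj. Qed.

Lemma cut_family_admissible : admissible K d cut_family.
Proof.
have sub p : cut_family p \subset S.
  by apply/fintype.subsetP => t; rewrite ffunE => /imsetP[x _ ->]; exact: simplexS.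
have nz b : (-1) ^+ b != 0 :> R by rewrite signr_eq0.
apply/and3P; split.
- by apply/forallP.
- apply/forallP => p; apply/forallP => q; apply/implyP => pq.
  rewrite disjoint_subset; apply/fintype.subsetP => t.
  rewrite {1}ffunE => /imsetP[x]; rewrite inE => /eqP px ->.
  rewrite inE mem_cut_family; apply: contraNneq pq => qx.
  have pq1 : p.1 = q.1.
    by apply: contraNeq (nz p.2) => pq; rewrite -px (chi_dis (i := q.1)) ?qx // eq_sym.
  move: px qx; rewrite pq1 => -> /signr_inj; case: p q pq1 => [i b] [j c] /= -> ->.
  by [].
- apply/forallP => i; have [x xi] := chi_neq0 i; apply/set0Pn; exists (simplex x).
  rewrite finset.in_setU !mem_cut_family /= expr0 expr1.
  by case: (chi_pm i x) xi => ->; rewrite ?eqxx ?orbT.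
Qed.

Lemma split_cut_family i x :
  split_fun R (cut_family (i, false)) (cut_family (i, true)) x = chi i x.
Proof.
rewrite /split_fun !mem_cut_family /= expr0 expr1.
have n11 : (1 == -1 :> R) = false by rewrite gt_eqF //; lra.
case: (chi_pm i x) => ->; rewrite ?eqxx ?n11 ?[-1 == 1]eq_sym ?n11 ?subr0 ?sub0r //.
by rewrite eq_sym oner_eq0 eq_sym oppr_eq0 oner_eq0 subr0.
Qed.

Lemma beta_cut_family i :
  beta K o d R (cut_family (i, false)) (cut_family (i, true))
    = variation G (chi i) / mass G (chi i).
Proof.
have /and3P[/forallP sub /forallP dis _] := cut_family_admissible.
rewrite (@beta_variation V K o d R orientK cofaceK) ?sub //.
  by congr (_ / _); congr (_ G _); apply/funext => x; exact: split_cut_family.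
by have /forallP/(_ (i, true))/implyP := dis (i, false); apply; rewrite xpair_eqE andbF.
Qed.

Lemma cheeger_le_cuts c : 0 <= c ->
  (forall i, variation G (chi i) ^+ 2 <= c ^+ 2 * mass G (chi i) ^+ 2) ->
  cheeger K o d R k <= c.
Proof.
move=> c0 hc; apply: le_trans (cheeger_le cut_family_admissible) _.
apply: (big_ind (fun x => x <= c)) => // [x y xc yc|i _]; first by rewrite ge_max xc.
have [x xi] := chi_neq0 i; have m0 := mass_gt0 G xi.
rewrite beta_cut_family ler_pdivrMr //.
rewrite -(ler_pXn2r (ltn0Sn 1)) ?nnegrE ?variation_ge0 ?(mulr_ge0 c0 (ltW m0)) //.
by rewrite [leRHS]exprMn; exact: hc.
Qed.
End Cuts.

(** Each g_i is swept separately; the resulting cuts lie in the disjoint supports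
    of the g_i. *)
Lemma cheeger_sqr_le k (g : 'I_k -> 'I_n -> R) (B : R) : 0 <= B ->
  (forall i, 0 < inner G (g i) (g i)) ->
  (forall i j x, i != j -> g i x != 0 -> g j x = 0) ->
  (forall i, energy G (g i) <= B * inner G (g i) (g i)) ->
  cheeger K o d R k ^+ 2 <= 2 * d.+1%:R * B.
Proof.
move=> B0 g_gt0 g_dis g_energy.
have degD x : \sum_y weight G x y <= d.+1%:R * vmass G x.
  by rewrite /= (sum_coface_weight complexK).
have ex i : exists chi : 'I_n -> R,
  [/\ exists x, chi x != 0,
      forall x, [\/ chi x = 0, chi x = 1 | chi x = -1],
      forall x, g i x = 0 -> chi x = 0
    & variation G chi ^+ 2 <= 2 * d.+1%:R * B * mass G chi ^+ 2].
  have [x gx] : exists x, g i x != 0.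
    apply: contrapT => none; have := g_gt0 i.
    rewrite /inner big1 ?ltxx // => x _; have [->|gx] := eqVneq (g i x) 0.
      by rewrite !mulr0.
    by case: none; exists x.
  have [chi [c1 c2 c3 c4]] := cheeger_cut degD gx.
  exists chi; split=> //; rewrite -(ler_pM2r (g_gt0 i)); apply: (le_trans c4).
  have D0 : 0 <= 2 * d.+1%:R * mass G chi ^+ 2 by rewrite mulr_ge0 ?sqr_ge0 // mulr_ge0.
  by have := ler_wpM2l D0 (g_energy i); lra.
have [chi hchi] := choice ex.
have chi_pm i x : [\/ chi i x = 0, chi i x = 1 | chi i x = -1].
  by have [_ h _ _] := hchi i.
have chi_neq0 i : exists x, chi i x != 0 by have [h _ _ _] := hchi i.
have chi_dis i j x : i != j -> chi i x != 0 -> chi j x = 0.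
  move=> ij cx; have [_ _ hi _] := hchi i; have [_ _ hj _] := hchi j.
  by apply: hj; apply: g_dis ij _; apply: contraNneq cx => /hi ->.
have D0 : 0 <= 2 * d.+1%:R * B by rewrite !mulr_ge0.
have adm := cut_family_admissible chi_pm chi_neq0 chi_dis.
rewrite -(sqr_sqrtr D0) lerXn2r ?nnegrE ?sqrtr_ge0 ?(cheeger_ge0 adm) //.
apply: (cheeger_le_cuts chi_pm chi_neq0 chi_dis); rewrite ?sqrtr_ge0 // => i.
by rewrite sqr_sqrtr //; have [_ _ _ h] := hchi i.
Qed.

Section Bounds.
Variables (lam : seq R).
Hypothesis spec : up_spectrum K o d lam.

Lemma size_spectrum : size lam = n.
Proof.
have [_ ch] := spec; have := size_char_poly (up_laplacian K o d R).
by rewrite ch size_prod_XsubC => -[].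
Qed.

Lemma spectrum_le (i j : nat) : (i <= j < n)%N -> lam`_i <= lam`_j.
Proof.
case/andP=> ij jn; have [srt _] := spec.
by apply: (sorted_leq_nth le_trans le_refl 0 srt) => //; rewrite inE size_spectrum //;
  exact: leq_ltn_trans ij jn.
Qed.

(** The min-max principle on the span of the functions 1_A(2i-1) - 1_A(2i): it has
    dimension k, so it contains a nonzero f orthogonal to the k - 1
    eigenvectors of index greater than n - k (counted from 0). *)
Lemma eigenvalue_le_max_beta k (A : family k) : (1 <= k <= n)%N ->
  admissible K d A -> d.+2%:R - lam`_(n - k) <= 2 * max_beta K o d R A.
Proof.
move=> /andP[k0 kn] /and3P[/forallP sub /forallP dis /forallP ne].
have [F [orthoF parsevalF energyF]] := eigenbasis complexK orientK cofaceK spec.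
pose chi i := split_fun R (A (i, false)) (A (i, true)) : 'I_n -> R.
have disj p q : p != q -> [disjoint A p & A q].
  by move=> pq; have /forallP/(_ q)/implyP := dis p; apply.
have chiE i x : chi i x = (simplex x \in A (i, false))%:R - (simplex x \in A (i, true))%:R by [].
have chi_dis i j x : i != j -> chi i x != 0 -> chi j x = 0.
  move=> ij; rewrite !chiE.
  have d1 b c t : t \in A (i, b) -> t \in A (j, c) = false.
    by move=> tA; rewrite (disjointFr (disj (i, b) (j, c) _) tA) // xpair_eqE (negbTE ij).
  have [h|_] := boolP (simplex x \in A (i, false)); first by rewrite !(d1 _ _ _ h) subrr.
  have [h|_] := boolP (simplex x \in A (i, true)); first by rewrite !(d1 _ _ _ h) subrr.
  by rewrite subrr eqxx.
have chi_pm i x : [\/ chi i x = 0, chi i x = 1 | chi i x = -1].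
  rewrite chiE; case: (_ \in _); case: (_ \in _) => /=;
    rewrite ?subrr ?subr0 ?sub0r; by [constructor 1 | constructor 2 | constructor 3].
have chi_mass i : mass G (chi i) = inner G (chi i) (chi i).
  apply: eq_bigr => x _; congr (_ * _).
  by case: (chi_pm i x) => ->; rewrite ?normr0 ?mulr0 ?normr1 ?mulr1 ?normrN1 ?mulrNN ?mulr1.
have chi_gt0 i : 0 < mass G (chi i).
  have /set0Pn[t tU] := ne i.
  have tS : t \in S.
    by move: tU; rewrite finset.in_setU => /orP[]; apply: fintype.subsetP.
  have [x tx] : exists x, t = simplex x.
    by exists (enum_rank_in tS t); rewrite /simplex enum_rankK_in.
  move: tU; rewrite tx finset.in_setU => tA; apply: (@mass_gt0 _ _ _ _ x); rewrite chiE.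
  have dd : [disjoint A (i, false) & A (i, true)] by apply: disj; rewrite xpair_eqE andbF.
  case/orP: tA => tA; first by rewrite tA (disjointFr dd tA) subr0 oner_neq0.
  by rewrite tA (disjointFl dd tA) sub0r oppr_eq0 oner_neq0.
have beta_le i : variation G (chi i) <= max_beta K o d R A * mass G (chi i).
  rewrite -ler_pdivrMr // -(@beta_variation V K o d R orientK cofaceK) ?sub //;
    last by rewrite disj // xpair_eqE andbF.
  by rewrite /max_beta (bigD1 i) //= le_max lexx.
have [c c0 cort] : exists2 c : 'I_k -> R, exists i, c i != 0 &
    forall j : 'I_n, (n - k < j)%N -> \sum_i c i * inner G (chi i) (F j) = 0.
  pose top (j : nat) : 'I_n -> R := if insub (n - k + j.+1)%N is Some x then F x else fun=> 0.
  pose M := \matrix_(i < k, j < k.-1) inner G (chi i) (top j).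
  have : kermx M != 0.
    rewrite -mxrank_eq0 mxrank_ker subn_eq0 -ltnNge.
    by apply: leq_ltn_trans (rank_leq_col M) _; rewrite prednK.
  move=> /rowV0Pn[v /sub_kermxP vM v0]; exists (fun i => v 0 i).
    apply: contrapT => h; case/eqP: v0; apply/rowP => i; rewrite mxE.
    by apply: contrapT => vi; apply: h; exists i; apply/eqP.
  move=> j jk.
  have jlt : (j - (n - k).+1 < k.-1)%N.
    by have := ltn_ord j; move: (nat_of_ord j) jk; lia.
  transitivity ((v *m M) 0 (Ordinal jlt)); last by rewrite vM mxE.
  rewrite mxE; apply: eq_bigr => i _; rewrite mxE /top /=; congr (_ * inner G _ _).
  have -> : (n - k + (j - (n - k).+1).+1)%N = j by lia.
  case: insubP => [x _ ex|]; last by rewrite ltn_ord.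
  by have -> : x = j by apply: val_inj.
pose f x := \sum_i c i * chi i x.
have ipf h : inner G f h = \sum_i c i * inner G (chi i) h.
  rewrite /inner; under [RHS]eq_bigr do rewrite mulr_sumr.
  rewrite exchange_big; apply: eq_bigr => x _ /=.
  by rewrite /f mulr_suml mulr_sumr; apply: eq_bigr => i _; ring.
have ipff : inner G f f = \sum_i c i ^+ 2 * mass G (chi i).
  rewrite ipf; apply: eq_bigr => i _; rewrite expr2 -mulrA; congr (_ * _).
  rewrite chi_mass /inner mulr_sumr; apply: eq_bigr => x _; rewrite [RHS]mulrCA; congr (_ * _).
  have [->|cx] := eqVneq (chi i x) 0; first by rewrite !mul0r mulr0.
  rewrite /f (bigD1 i) //= big1 ?addr0; first by ring.
  by move=> j ji; rewrite (chi_dis i j) ?mulr0 // eq_sym.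
have f_gt0 : 0 < inner G f f.
  rewrite ipff; have [i ci] := c0; rewrite (bigD1 i) //= ltr_pwDl //.
    by rewrite mulr_gt0 // lt_def sqr_ge0 sqrf_eq0 ci.
  by apply: sumr_ge0 => j _; rewrite mulr_ge0 ?sqr_ge0 // ltW.
rewrite -(ler_pM2r f_gt0); apply: (@le_trans _ _ (energy G f)).
  rewrite energyF [in leLHS]parsevalF mulr_sumr; apply: ler_sum => j _.
  have [jk|kj] := leqP j (n - k).
    rewrite ler_wpM2r ?sqr_ge0 // lerD2l lerN2 spectrum_le // jk /=.
    by rewrite -subn_gt0 subKn // ltn_subrL k0 (leq_trans k0).
  by rewrite ipf cort // expr0n !mulr0.
apply: (le_trans (energy_combination_le G c (h := chi) _)) => [x|].
  have [i ix|no] := pickP (fun i => chi i x != 0).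
    rewrite (bigD1 i) //= big1 ?addr0 => [|j ji]; last by rewrite (chi_dis i j) ?normr0 // eq_sym.
    by case: (chi_pm i x) => ->; rewrite ?normr0 ?normrN1 ?normr1.
  by rewrite big1 // => i _; have /negbFE/eqP -> := no i; rewrite normr0.
rewrite -mulrA ler_wpM2l // ipff mulr_sumr; apply: ler_sum => i _.
by rewrite [leRHS]mulrCA ler_wpM2l ?sqr_ge0.
Qed.

(** A single eigenvector is swept directly, which avoids the constant of
    [localization]. *)
Lemma cheeger1_sqr_le : (0 < n)%N ->
  cheeger K o d R 1 ^+ 2 / (2 * d.+1%:R) <= d.+2%:R - lam`_(n - 1).
Proof.
move=> n0; have [F [orthoF _ energyF]] := eigenbasis complexK orientK cofaceK spec.
have jn : (n - 1 < n)%N by rewrite subn1 prednK.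
pose j := Ordinal jn.
have Ej : energy G (F j) = d.+2%:R - lam`_(n - 1).
  rewrite energyF (bigD1 j) //= orthoF eqxx expr1n mulr1 big1 ?addr0 // => i ij.
  by rewrite orthoF eq_sym (negbTE ij) expr0n mulr0.
have E0 := energy_ge0 G (F j); rewrite Ej in E0.
rewrite ler_pdivrMr ?mulr_gt0 // mulrC.
apply: (cheeger_sqr_le (g := fun=> F j)) => // [i|i i' x|i].
- by rewrite orthoF eqxx.
- by rewrite !ord1 eqxx.
- by rewrite orthoF eqxx mulr1 Ej.
Qed.

(** The last k eigenvectors have total energy at most k mu, so [localization]
    gives quotients at most 40 * 2^13 k^5 mu, and the sweep adds the factor
    2 (d + 1); finally k^5 <= k^6. *)
Lemma cheeger_sqr_le_eigenvalue k : (1 <= k <= n)%N ->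
  cheeger K o d R k ^+ 2 / (80 * 2 ^+ 13 * k%:R ^+ 6 * d.+1%:R)
    <= d.+2%:R - lam`_(n - k).
Proof.
move=> /andP[k0 kn].
have [F [orthoF _ energyF]] := eigenbasis complexK orientK cofaceK spec.
have topP (i : 'I_k) : (n - k + i < n)%N by have := ltn_ord i; lia.
pose F' i := F (Ordinal (topP i)).
set mu := d.+2%:R - lam`_(n - k).
have orthoF' i j : inner G (F' i) (F' j) = (i == j)%:R.
  by rewrite orthoF -val_eqE /= eqn_add2l.
have Ele i : energy G (F' i) <= mu.
  rewrite energyF (bigD1 (Ordinal (topP i))) //= orthoF eqxx expr1n mulr1 big1 ?addr0.
    by rewrite lerD2l lerN2 spectrum_le // leq_addr topP.
  by move=> j ij; rewrite orthoF eq_sym (negbTE ij) expr0n mulr0.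
have mu0 : 0 <= mu by apply: le_trans (Ele (Ordinal k0)); exact: energy_ge0.
have [g [g1 g2 g3]] := localization k0 orthoF'.
have kp : 1 <= k%:R :> R by rewrite ler1n.
have c0 : 0 <= 2 ^+ 13 :> R by rewrite exprn_ge0.
have Etot : \sum_j energy G (F' j) <= k%:R * mu.
  apply: (@le_trans _ _ (\sum_(j < k) mu)); first exact: ler_sum.
  by rewrite sumr_const card_ord -[_ *+ k]mulr_natl.
have g4 i : energy G (g i) <= (40 * 2 ^+ 13 * k%:R ^+ 6 * mu) * inner G (g i) (g i).
  apply: (le_trans (g3 i)); rewrite ler_wpM2r ?(ltW (g1 i)) //.
  rewrite -!(mulrA (40 * _)) ler_wpM2l ?mulr_ge0 //.
  apply: (@le_trans _ _ (k%:R ^+ 4 * (k%:R * mu))); first by rewrite ler_wpM2l ?exprn_ge0.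
  by rewrite mulrA -exprSr ler_wpM2r // ler_weXn2l.
have /cheeger_sqr_le H : 0 <= 40 * 2 ^+ 13 * k%:R ^+ 6 * mu.
  by rewrite !mulr_ge0 ?exprn_ge0.
have := H _ _ g1 g2 g4.
rewrite ler_pdivrMr ?mulr_gt0 ?exprn_gt0 ?ltr0n // => /le_trans; apply.
by rewrite le_eqVlt; apply/orP; left; apply/eqP; ring.
Qed.
End Bounds.
End CheegerInequality.

Theorem theorem4p5 (R : realType) :
  (forall (V : finType) (K : {set {set V}})
      (o : forall m : nat, {set V} -> m.+1.-tuple V) (d : nat) (lam : seq R),
    simplicial_complex K -> orientation K o ->
    every_simplex_in_coface K d -> (0 < #|simplices K d|)%N ->
    up_spectrum K o d lam ->
    cheeger K o d R 1 ^+ 2 / (2 * d.+1%:R)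
      <= d.+2%:R - lambda lam #|simplices K d| <= 2 * cheeger K o d R 1)
  /\
  (exists2 C : R, 0 < C &
    forall (V : finType) (K : {set {set V}})
      (o : forall m : nat, {set V} -> m.+1.-tuple V) (d : nat) (lam : seq R)
      (k : nat),
    simplicial_complex K -> orientation K o ->
    every_simplex_in_coface K d -> (1 <= k <= #|simplices K d|)%N ->
    up_spectrum K o d lam ->
    cheeger K o d R k ^+ 2 / (C * k%:R ^+ 6 * d.+1%:R)
      <= d.+2%:R - lambda lam (#|simplices K d| + 1 - k) <= 2 * cheeger K o d R k).
Proof.
have upper (V : finType) (K : {set {set V}}) o d (lam : seq R) k :
    simplicial_complex K -> orientation K o -> every_simplex_in_coface K d ->
    (1 <= k <= #|simplices K d|)%N -> up_spectrum K o d lam ->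
    d.+2%:R - lam`_(#|simplices K d| - k) <= 2 * cheeger K o d R k.
  move=> cK oK fK kn spec; have /andP[_ kn'] := kn.
  have [A0 A0ok] := exists_admissible kn'.
  have [A Aok [-> _]] := cheeger_min o R A0ok.
  exact: eigenvalue_le_max_beta.
split=> [V K o d lam cK oK fK n0 spec|].
  rewrite /lambda -subn1; apply/andP; split; first exact: cheeger1_sqr_le.
  exact: upper.
exists (80 * 2 ^+ 13) => [|V K o d lam k cK oK fK kn spec].
  by rewrite mulr_gt0 // exprn_gt0.
have -> : lambda lam (#|simplices K d| + 1 - k) = lam`_(#|simplices K d| - k).
  by rewrite /lambda; congr (lam`_ _); lia.
by apply/andP; split; [exact: cheeger_sqr_le_eigenvalue | exact: upper].
Qed.
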